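(* Let $\mathcal{M}$ be a smooth 4-dimensional manifold, and let $g_{ab}$ and $\tilde g_{ab}$ be smooth pseudo-Riemannian metrics on $\mathcal{M}$ with $g_{ab}=\Theta^2\tilde g_{ab}$ for a smooth positive function $\Theta$. Assume that $C_{abcd}C^{abcd}\neq0$ at every point, where $C_{abcd}$ is the Weyl tensor of $g_{ab}$. Let the tensor $K^{a_1\dots a_p}{}_{b_1\dots b_q}$ be a metric concomitant of $g_{ab}$, with counterpart $\tilde K^{a_1\dots a_p}{}_{b_1\dots b_q}$ for $\tilde g_{ab}$, and assume that it is conformally covariant of weight $s\in\mathbb{Z}$: $$\tilde K^{a_1\dots a_p}{}_{b_1\dots b_q}=\Theta^sK^{a_1\dots a_p}{}_{b_1\dots b_q}.$$ Then its conformal pseudo-differential $D_a^{s,(p,q)}:\mathcal{T}^p_q(\mathcal{M})\to\mathcal{T}^p_{q+1}(\mathcal{M})$, $(p,q)\neq(0,0)$, defined by $$D_a^{s,(p,q)}K^{a_1\dots a_p}{}_{b_1\dots b_q}=\nabla_aK^{a_1\dots a_p}{}_{b_1\dots b_q}+\sum_{j=1}^p\bar M^{a_j}{}_{ac}(\boldsymbol\Lambda,\boldsymbol g,p,s)\,K^{a_1\dots a_{j-1}c\,a_{j+1}\dots a_p}{}_{b_1\dots b_q}+\sum_{j=1}^qM^c{}_{ab_j}(\boldsymbol\Lambda,\boldsymbol g,p,s)\,K^{a_1\dots a_p}{}_{b_1\dots b_{j-1}c\,b_{j+1}\dots b_q},$$ is also conformally covariant with the same weight: $$\tilde D_a^{s,(p,q)}\tilde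 K^{a_1\dots a_p}{}_{b_1\dots b_q}=\Theta^sD_a^{s,(p,q)}K^{a_1\dots a_p}{}_{b_1\dots b_q},$$ where $$M^c{}_{ba}(\boldsymbol\Lambda,\boldsymbol g,p,s)=\Big(\frac{s+p}{p}\Big)\Lambda_b\delta_a{}^c+\Lambda_a\delta_b{}^c-g_{ab}g^{cd}\Lambda_d,$$ $$\bar M^c{}_{ba}(\boldsymbol\Lambda,\boldsymbol g,p,s)=\Big(\frac{s-p}{p}\Big)\Lambda_b\delta_a{}^c-\Lambda_a\delta_b{}^c+g_{ab}g^{cr}\Lambda_r.$$
   Context: Abstract index notation is used; square brackets denote antisymmetrization with weight one. $\mathcal{T}^p_q(\mathcal{M})$ is the set of smooth $p$-contravariant, $q$-covariant tensor fields on $\mathcal{M}$. A metric concomitant is a tensorial object defined exclusively in terms of a metric and its Levi-Civita connection; its counterpart for $\tilde g_{ab}$ (denoted with a tilde) is the object given by the same construction applied to $\tilde g_{ab}$ and its Levi-Civita connection $\tilde\nabla$. Boldface denotes the covariant form of a tensor. For a pseudo-Riemannian metric $g_{ab}$ with Levi-Civita connection $\nabla$, indices being raised and lowered with $g_{ab}$, the curvature conventions are: $\nabla_a\nabla_b\omega_c-\nabla_b\nabla_a\omega_c=R_{abc}{}^d\omega_d$; $R_{ac}=R_{abc}{}^b$; $R=g^{ab}R_{ab}$; Schouten tensor $L_{ab}=\frac12(R_{ab}-\frac16Rg_{ab})$; Weyl tensor $C_{abc}{}^d=R_{abc}{}^d-2L^d{}_{[b}g_{a]c}-2\delta^d{}_{[b}L_{a]c}$.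 Where $C\cdot C=C_{abcd}C^{abcd}$ is nowhere zero, define the covector field $$\Lambda_d=\frac{8\,C_d{}^{amp}\nabla_{[m}L_{p]a}}{C\cdot C}.$$ The covector $\tilde\Lambda_d$ and the operator $\tilde D_a^{s,(p,q)}$ are defined by the same formulas with every object ($g$, its inverse, $\nabla$, curvature tensors, index raising, $\Lambda$) replaced by the one constructed from $\tilde g_{ab}$.
   Formalization: In the definition of D the third argument of M and M̄ is taken to be p+q instead of p: with p the operator is undefined for p=0, and the claim fails when p,q>0 and s≠0 (e.g. K^a_b=(C·C)δ^a_b, s=4); for q=0 nothing changes. *)

(* Defs.v *)
From HB Require Import structures.
From mathcomp Require Import all_boot all_order all_algebra.
From mathcomp Require Import all_classical all_reals all_analysis.

Set Implicit Arguments.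
Unset Strict Implicit.
Unset Printing Implicit Defensive.

Import Order.TTheory GRing.Theory Num.Theory.
Import numFieldNormedType.Exports.

Local Open Scope classical_set_scope.
Local Open Scope ring_scope.

Notation pt R := 'rV[R]_4.
Notation idx k := (k.-tuple 'I_4).

(* Components of a p-contravariant, q-covariant tensor field in one coordinate
   system: upper indices, lower indices, coordinates of the point. *)
Notation comps R p q := (idx p -> idx q -> pt R -> R).

Definition partial (R : realType) (a : 'I_4) (f : pt R -> R) : pt R -> R :=
  fun x => 'D_(delta_mx 0 a) f x.

(* C^oo: all iterated partial derivatives are differentiable.  Only the germ of
   [f] at the points of the open set [U] matters. *)
Definition smooth_on (R : realType) (U : set (pt R)) (f : pt R -> R) : Prop :=
  forall (l : seq 'I_4) (x : pt R), U x ->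
    differentiable (foldr (@partial R) f l) x.

Definition smooth_map_on (R : realType) (U : set (pt R))
    (psi : pt R -> pt R) : Prop :=
  forall a : 'I_4, smooth_on U (fun x => psi x 0 a).

Definition diffeo (R : realType) (U V : set (pt R))
    (psi chi : pt R -> pt R) : Prop :=
  [/\ open U /\ open V,
      (forall x, U x -> V (psi x) /\ chi (psi x) = x),
      (forall y, V y -> U (chi y) /\ psi (chi y) = y),
      smooth_map_on U psi & smooth_map_on V chi].

(* [T'] at [psi x] is obtained from [T] at [x] by the tensor transformation law
   for the change of coordinates [psi], whose inverse is [chi]. *)
Definition tensor_law (R : realType) (psi chi : pt R -> pt R) (p q : nat)
    (T T' : comps R p q) (x : pt R) : Prop :=
  forall (A : idx p) (B : idx q),
    T' A B (psi x) =
    \sum_(A' : idx p) \sum_(B' : idx q)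
      (\prod_(k < p)
         partial (tnth A' k) (fun z => psi z 0 (tnth A k)) x) *
      (\prod_(k < q)
         partial (tnth B k) (fun z => chi z 0 (tnth B' k)) (psi x)) *
      T A' B' x.

Record chart (R : realType) (M : topologicalType) := Chart {
  cdom : set M;
  cmap : M -> pt R;
  cinv : pt R -> M;
  cdom_open : open cdom;
  cimg_open : open (cmap @` cdom);
  cmapK : forall m, cdom m -> cinv (cmap m) = m;
  cmap_cts : forall m, cdom m -> {for m, continuous cmap};
  cinv_cts : forall x, (cmap @` cdom) x -> {for x, continuous cinv}
}.

Record manifold4 (R : realType) := Manifold4 {
  points :> topologicalType;
  points_hausdorff : hausdorff_space points;
  points_second_countable : @second_countable points;
  atlas : Type;
  chart_of : atlas -> chart R points;
  atlas_cover : forall m : points, exists i, cdom (chart_of i) m;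
  atlas_smooth : forall i j,
    smooth_map_on
      (cmap (chart_of i) @` (cdom (chart_of i) `&` cdom (chart_of j)))
      (cmap (chart_of j) \o cinv (chart_of i))
}.

Definition coord_dom (R : realType) (M : manifold4 R) (i : atlas M) :
    set (pt R) :=
  cmap (chart_of i) @` cdom (chart_of i).

Definition smooth_fun (R : realType) (M : manifold4 R) (f : M -> R) : Prop :=
  forall i : atlas M, smooth_on (coord_dom i) (f \o cinv (chart_of i)).

(* The values of [tcomps i] outside [coord_dom i] are irrelevant. *)
Record tensor_field (R : realType) (M : manifold4 R) (p q : nat) :=
  TensorField {
  tcomps :> atlas M -> comps R p q;
  tcomps_smooth : forall i A B, smooth_on (coord_dom i) (tcomps i A B);
  tcomps_law : forall i j x,
    (cmap (chart_of i) @` (cdom (chart_of i) `&` cdom (chart_of j))) x ->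
    tensor_law (cmap (chart_of j) \o cinv (chart_of i))
               (cmap (chart_of i) \o cinv (chart_of j))
               (tcomps i) (tcomps j) x
}.

Section LocalGeometry.
Variable R : realType.

Definition gmx (g : comps R 0 2) (x : pt R) : 'M[R]_4 :=
  \matrix_(a, b) g [tuple] [tuple a; b] x.

Definition metric_on (U : set (pt R)) (g : comps R 0 2) : Prop :=
  (forall A B, smooth_on U (g A B)) /\
  (forall x, U x -> (gmx g x)^T = gmx g x /\ gmx g x \in unitmx).

Variable g : comps R 0 2.

Definition glo (a b : 'I_4) (x : pt R) : R := gmx g x a b.
Definition gup (a b : 'I_4) (x : pt R) : R := invmx (gmx g x) a b.
Definition kron (a b : 'I_4) : R := (a == b)%:R.

(* Gamma^c_{ab} *)
Definition christoffel (c a b : 'I_4) (x : pt R) : R :=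
  2^-1 * \sum_d gup c d x *
    (partial a (glo b d) x + partial b (glo a d) x - partial d (glo a b) x).

Definition subst_idx (k : nat) (A : idx k) (j : 'I_k) (c : 'I_4) : idx k :=
  [tuple if i == j then c else tnth A i | i < k].

(* Levi-Civita covariant derivative; the index of the derivative is the first
   covariant index of the result. *)
Definition nabla (p q : nat) (K : comps R p q) : comps R p q.+1 :=
  fun A aB x =>
    let a := thead aB in
    let B := [tuple of behead aB] in
    partial a (K A B) x
    + \sum_(j < p) \sum_c
        christoffel (tnth A j) a c x * K (subst_idx A j c) B x
    - \sum_(j < q) \sum_c
        christoffel c a (tnth B j) x * K A (subst_idx B j c) x.

Definition coord_covector (d : 'I_4) : comps R 0 1 :=
  fun _ B _ => kron (thead B) d.

(* R_{abc}^d: the defining identity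
     nabla_a nabla_b w_c - nabla_b nabla_a w_c = R_{abc}^e w_e
   evaluated at the coordinate covector field w = dx^d. *)
Definition riemann (a b c d : 'I_4) (x : pt R) : R :=
  let ddw := nabla (nabla (coord_covector d)) in
  ddw [tuple] [tuple a; b; c] x - ddw [tuple] [tuple b; a; c] x.

Definition ricci (a c : 'I_4) (x : pt R) : R := \sum_b riemann a b c b x.

Definition scalar_curv (x : pt R) : R :=
  \sum_a \sum_b gup a b x * ricci a b x.

Definition schouten : comps R 0 2 := fun _ B x =>
  let a := tnth B 0 in
  let b := tnth B 1 in
  2^-1 * (ricci a b x - 6^-1 * scalar_curv x * glo a b x).

Definition Llo (a b : 'I_4) (x : pt R) : R := schouten [tuple] [tuple a; b] x.

(* L^d_b *)
Definition Lmixed (d b : 'I_4) (x : pt R) : R := \sum_e gup d e x * Llo e b x.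

(* C_{abc}^d *)
Definition weyl (a b c d : 'I_4) (x : pt R) : R :=
  riemann a b c d x
  - (Lmixed d b x * glo a c x - Lmixed d a x * glo b c x)
  - (kron d b * Llo a c x - kron d a * Llo b c x).

(* C_{abcd} *)
Definition weyl_lo (a b c d : 'I_4) (x : pt R) : R :=
  \sum_e weyl a b c e x * glo e d x.

(* C_d^{amp} *)
Definition weyl_up3 (d a m p : 'I_4) (x : pt R) : R :=
  \sum_a' \sum_m' \sum_p'
    weyl_lo d a' m' p' x * gup a' a x * gup m' m x * gup p' p x.

(* C_{abcd} C^{abcd} *)
Definition weyl_sq (x : pt R) : R :=
  \sum_a \sum_b \sum_c \sum_d
    weyl_lo a b c d x * \sum_a' gup a a' x * weyl_up3 a' b c d x.

(* nabla_m L_{pa} *)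
Definition nabla_L (m p a : 'I_4) (x : pt R) : R :=
  nabla schouten [tuple] [tuple m; p; a] x.

Definition Lambda (d : 'I_4) (x : pt R) : R :=
  8 * (\sum_a \sum_m \sum_p
         weyl_up3 d a m p x * (2^-1 * (nabla_L m p a x - nabla_L p m a x)))
  / weyl_sq x.

(* M^c_{ba}(Lambda, g, r, s) *)
Definition Mcov (r : nat) (s : int) (c b a : 'I_4) (x : pt R) : R :=
  (s%:~R + r%:R) / r%:R * Lambda b x * kron a c
  + Lambda a x * kron b c
  - glo a b x * \sum_d gup c d x * Lambda d x.

(* \bar M^c_{ba}(Lambda, g, r, s) *)
Definition Mcon (r : nat) (s : int) (c b a : 'I_4) (x : pt R) : R :=
  (s%:~R - r%:R) / r%:R * Lambda b x * kron a c
  - Lambda a x * kron b c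
  + glo a b x * \sum_d gup c d x * Lambda d x.

(* Conformal pseudo-differential D_a^{s,(p,q)}.  The rank parameter of M and
   \bar M is the total number p + q of indices of K: there are p + q correction
   terms, each of which contributes (s / r) Lambda_a K to the sum, and these
   must add up to s Lambda_a K. *)
Definition Dconf (s : int) (p q : nat) (K : comps R p q) : comps R p q.+1 :=
  fun A aB x =>
    let a := thead aB in
    let B := [tuple of behead aB] in
    nabla K A aB x
    + \sum_(j < p) \sum_c
        Mcon (p + q) s (tnth A j) a c x * K (subst_idx A j c) B x
    + \sum_(j < q) \sum_c
        Mcov (p + q) s c a (tnth B j) x * K A (subst_idx B j c) x.

End LocalGeometry.

Record metric (R : realType) (M : manifold4 R) := Metric {
  metric_tensor :> tensor_field M 0 2;
  metric_nondeg : forall i, metric_on (coord_dom i) (metric_tensor i)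
}.

(* A tensorial construction from a metric (and so from its Levi-Civita
   connection) alone: a rule [F] assigning tensor components to metric
   components and commuting with every change of coordinates between open
   subsets of R^4.  Taking [psi = id] on a smaller open set shows that [F] is
   local.  A construction that only makes sense for some metrics (e.g. one with
   a denominator) is extended by 0 to the others; smoothness of the resulting
   field is required separately, where the construction is used. *)
Definition concomitant (R : realType) (p q : nat)
    (F : comps R 0 2 -> comps R p q) : Prop :=
  forall (U V : set (pt R)) (psi chi : pt R -> pt R) (h h' : comps R 0 2),
    diffeo U V psi chi -> metric_on U h -> metric_on V h' ->
    (forall x, U x -> tensor_law psi chi h h' x) ->
    forall x, U x -> tensor_law psi chi (F h) (F h') x.

Definition built_from (R : realType) (M : manifold4 R) (p q : nat)
    (F : comps R 0 2 -> comps R p q) (g : metric M) (K : tensor_field M p q) :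
    Prop :=
  forall i x, coord_dom i x -> forall A B, K i A B x = F (g i) A B x.

Definition conf_covariant (R : realType) (M : manifold4 R) (Th : M -> R)
    (s : int) (p q : nat) (T Tt : atlas M -> comps R p q) : Prop :=
  forall i x, coord_dom i x -> forall A B,
    Tt i A B x = Th (cinv (chart_of i) x) ^ s * T i A B x.

(* Main.v *)
Require Import Defs.
From mathcomp Require Import all_boot all_order all_algebra.
From mathcomp Require Import all_classical all_reals all_analysis.
From mathcomp Require Import ring lra.
Import Order.TTheory GRing.Theory Num.Theory.
Import numFieldNormedType.Exports.
Local Open Scope classical_set_scope.
Local Open Scope ring_scope.

Set Implicit Arguments.
Unset Strict Implicit.

(** Write [t] for the conformal factor, [u_a = d_a t / t] for its logarithmic
    gradient, and [gt = t^-2 g].  The Levi-Civita connections differ by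
    [Q^c_ab = - delta^c_a u_b - delta^c_b u_a + g_ab u^c] ([christoffel_conf]).
    Everything rests on the fact that [Lambda] transforms like a gauge field,
    [Lambda gt = Lambda g - u] ([Lambda_conf]).  Granting it, the terms of
    [M] and [Mbar] that do not contain the weight are, up to sign, the
    connection difference [Q] with [u] replaced by [Lambda], so they absorb the
    change of connection.  The remaining terms are multiples of [K]: each of the
    [p + q] indices contributes [- s / (p + q) * u_a], and their total
    [- s * u_a] cancels the derivative of the factor [t^s] that multiplies [K]
    ([Dconf_conformal]).

    To compute [Lambda gt], put
    [P_ab = nabla_a u_b + u_a u_b - (1/2) |u|^2 g_ab].
    Substituting [Gamma + Q] into the curvature changes it by the terms
    [delta^d_b P_ac - delta^d_a P_bc + g_ac P_b^d - g_bc P_a^d]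
    ([curv_conformal]).  Taking traces, the Schouten tensor becomes [L + P],
    hence the Weyl tensor [C_abc^d] is unchanged ([sch_conformal],
    [weyl_conformal]).  When [P] is differentiated, the Ricci identity makes
    the full curvature of [u] appear, and the terms in [L] coming from [Q]
    turn it into the Weyl tensor: the curl [nabla_m L_pa - nabla_p L_ma]
    changes by [C_mpa^d u_d] ([cotton_conformal], [nabla_L_conf]).

    Finally [Lambda] contracts this curl with [C_d^amp], which produces
    [C_d^amp C_mpae].  In dimension four this is [- (1/4) (C.C) g_de]
    ([weyl_contraction]).  Apart from the exchange symmetry of the two pairs of
    indices, only two facts about the Weyl tensor enter: with two indices raised
    it is a tensor [W^ab_cd] that is antisymmetric in each pair, and its trace
    vanishes.  The identity [4 W^mp_da W^ea_mp = delta^e_d W^ab_cd W^cd_ab]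
    for such tensors ([tracefree_square]) is special to dimension four, where
    antisymmetrizing over five indices gives zero.

    The curvature symmetries need the equality of mixed partial derivatives,
    which is proved from the mean value theorem ([derive_comm]).  All
    computations with index contractions are carried out for arrays of real
    numbers that hold the values of the fields and of their derivatives at one
    point; the geometric lemmas only supply the relations between these
    arrays. *)

(** * Symmetry of second directional derivatives *)

Section Schwarz.
Context {R : realType} {V : normedModType R}.
Implicit Types (f : V -> R) (x u v : V).

Lemma is_derive_line f x u (s : R) : derivable f (x + s *: u) u ->
  is_derive s 1 (fun t : R => f (x + t *: u)) ('D_u f (x + s *: u)).
Proof.
move=> df.
have E : (fun h : R => h^-1 *:
      (((fun t : R => f (x + t *: u)) \o shift s) (h *: 1) - f (x + s *: u)))
    = (fun h : R => h^-1 *: ((f \o shift (x + s *: u)) (h *: u) - f (x + s *: u))).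
  apply/funext => h /=.
  by rewrite /shift /= [h%:A]mulr1 scalerDl addrCA.
split; first by rewrite /derivable E.
by rewrite /derive E.
Qed.

Lemma derive_translate f w u x : 'D_u (fun y => f (y + w)) x = 'D_u f (x + w).
Proof.
have E : (fun h : R => h^-1 *:
      (((fun y => f (y + w)) \o shift x) (h *: u) - f (x + w)))
    = (fun h : R => h^-1 *: ((f \o shift (x + w)) (h *: u) - f (x + w))).
  by apply/funext => h /=; rewrite /shift /= addrA.
by rewrite /derive E.
Qed.

Lemma mean_value_line f x u (h : R) : 0 < h ->
  (forall s, 0 <= s <= h -> differentiable f (x + s *: u)) ->
  exists2 s, 0 <= s <= h & f (x + h *: u) - f x = 'D_u f (x + s *: u) * h.
Proof.
move=> h0 df.
have der s : 0 <= s <= h ->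
    is_derive s 1 (fun t : R => f (x + t *: u)) ('D_u f (x + s *: u)).
  by move=> sh; apply/is_derive_line/diff_derivable/df.
have [s| |s sh] := @MVT R (fun t => f (x + t *: u))
  (fun t => 'D_u f (x + t *: u)) 0 h h0.
- by rewrite in_itv /= => /andP[s0 sh]; apply: der; rewrite !ltW.
- apply: derivable_within_continuous => s; rewrite in_itv /= => sh.
  by have [] := der s sh.
- rewrite scale0r addr0 subr0 => ->; exists s => //.
  by move: sh; rewrite in_itv /= => /andP[s0 sh]; rewrite !ltW.
Qed.

(** The second difference of [f] on a square is a value of the second derivative:
    apply the mean value theorem first to [y |-> f (y + h v) - f y] along [u],
    then to ['D_u f] along [v]. *)
Lemma double_mean_value f x u v (h : R) : 0 < h ->
  (forall s t, 0 <= s <= h -> 0 <= t <= h ->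
     differentiable f (x + s *: u + t *: v) /\
     differentiable ('D_u f) (x + s *: u + t *: v)) ->
  exists s t, [/\ 0 <= s <= h, 0 <= t <= h &
    f (x + h *: u + h *: v) - f (x + h *: u) - (f (x + h *: v) - f x) =
    'D_v ('D_u f) (x + s *: u + t *: v) * h * h].
Proof.
move=> h0 df.
have h00 : 0 <= (0 : R) <= h by rewrite lexx ltW.
have hh : 0 <= h <= h by rewrite lexx ltW.
pose k y := f (y + h *: v) - f y.
have dfv s : 0 <= s <= h -> differentiable (fun y => f (y + h *: v)) (x + s *: u).
  move=> sh; apply: (@differentiable_comp _ _ _ _ (fun y => y + h *: v) f).
    exact: differentiableD.
  by have [] := df s h sh hh.
have df0 s : 0 <= s <= h -> differentiable f (x + s *: u).
  by move=> sh; have [] := df s 0 sh h00; rewrite scale0r addr0.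
have Dk s : 0 <= s <= h -> 'D_u k (x + s *: u) =
    'D_u f (x + s *: u + h *: v) - 'D_u f (x + s *: u).
  move=> sh; rewrite /k deriveB; last 2 first.
  - exact/diff_derivable/dfv.
  - exact/diff_derivable/df0.
  by rewrite derive_translate.
have [s sh Es] : exists2 s, 0 <= s <= h &
    k (x + h *: u) - k x = 'D_u k (x + s *: u) * h.
  apply: (@mean_value_line k x u h h0) => s sh.
  by apply: differentiableB; [exact: dfv|exact: df0].
have [t th Et] : exists2 t, 0 <= t <= h &
    'D_u f (x + s *: u + h *: v) - 'D_u f (x + s *: u) =
    'D_v ('D_u f) (x + s *: u + t *: v) * h.
  by apply: (@mean_value_line ('D_u f) (x + s *: u) v h h0) => t th; exact: (df s t sh th).2.
exists s, t; split=> //; rewrite -Et -Dk // -Es /k; ring.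
Qed.

Lemma continuous_eq_of_near (F G : V -> R) x :
  {for x, continuous F} -> {for x, continuous G} ->
  (forall d, 0 < d -> exists y z, [/\ ball x d y, ball x d z & F y = G z]) ->
  F x = G x.
Proof.
move=> cF cG H; apply/eqP; rewrite -subr_eq0 -normr_le0.
apply/ler_addgt0Pl => e e0; rewrite addr0.
have e20 : 0 < e / 2 by rewrite divr_gt0.
have /cvgrPdist_lt /(_ _ e20) /nbhs_ballP [d1 /= d10 H1] := cF.
have /cvgrPdist_lt /(_ _ e20) /nbhs_ballP [d2 /= d20 H2] := cG.
have D0 : 0 < Num.min d1 d2 by rewrite lt_min d10 d20.
have [y [z [By Bz E]]] := H _ D0.
have A : `|F x - F y| < e / 2.
  by apply/H1/(le_ball _ By); rewrite ge_min lexx.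
have B : `|G x - G z| < e / 2.
  by apply/H2/(le_ball _ Bz); rewrite ge_min lexx orbT.
rewrite -(subrKA (F y)) (splitr e); apply: le_trans (ler_normD _ _) _.
by apply: lerD; [exact: ltW|rewrite E distrC ltW].
Qed.

(** Exchanging [u] and [v] does not change the second difference, so the two mixed
    derivatives take equal values at points arbitrarily close to [x]; continuity
    does the rest. *)
Lemma derive_comm f x u v :
  (\forall y \near x, [/\ differentiable f y, differentiable ('D_u f) y
     & differentiable ('D_v f) y]) ->
  {for x, continuous ('D_u ('D_v f))} -> {for x, continuous ('D_v ('D_u f))} ->
  'D_u ('D_v f) x = 'D_v ('D_u f) x.
Proof.
move=> /nbhs_ballP[d /= d0 df] cuv cvu.
apply: (continuous_eq_of_near cuv cvu) => d1 d10.
pose D := Num.min d d1.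
have D0 : 0 < D by rewrite lt_min d0 d10.
pose n := `|u| + `|v| + 1.
have n0 : 0 < n by rewrite ltr_wpDl // addr_ge0.
pose h := D / 2 / n.
have h0 : 0 < h by rewrite !divr_gt0.
have near s t : 0 <= s <= h -> 0 <= t <= h -> ball x D (x + s *: u + t *: v).
  move=> /andP[s0 sh] /andP[t0 th]; rewrite -ball_normE /ball_ /=.
  rewrite opprD opprD addrA addrA subrr add0r -opprD normrN.
  rewrite (le_lt_trans (ler_normD _ _)) // !normrZ !ger0_norm //.
  apply: (@le_lt_trans _ _ (h * n)); last by rewrite /h divfK ?gt_eqF //; lra.
  have := ler_wpM2r (normr_ge0 u) sh; have := ler_wpM2r (normr_ge0 v) th.
  by rewrite /n !mulrDr mulr1; lra.
have Dd : D <= d by rewrite ge_min lexx.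
have Dd1 : D <= d1 by rewrite ge_min lexx orbT.
have [|s [t [sh th E1]]] := @double_mean_value f x u v h h0.
  by move=> s t sh th; have [? ? _] := df _ (le_ball Dd (near s t sh th)).
have [|t' [s' [th' sh' E2]]] := @double_mean_value f x v u h h0.
  move=> t' s' th' sh'; rewrite addrAC.
  by have [? _ ?] := df _ (le_ball Dd (near s' t' sh' th')).
exists (x + s' *: u + t' *: v), (x + s *: u + t *: v); split.
- exact: (le_ball Dd1 (near s' t' sh' th')).
- exact: (le_ball Dd1 (near s t sh th)).
have hn : h != 0 by rewrite gt_eqF.
apply: (mulIf hn); apply: (mulIf hn); apply: etrans _ E1.
rewrite [x + s' *: u + t' *: v]addrAC; apply: etrans (esym E2) _.
rewrite [x + h *: v + h *: u]addrAC.
move: (f _) (f _) (f _) (f _) => a1 a2 a3 a4; ring.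
Qed.

End Schwarz.

(** * Smooth functions on an open set *)

(** The differential of [f] serves for [g] too: the remainder estimate is a
    statement about the germ at [x]. *)
Lemma near_differentiable (R : realType) (V W : normedModType R)
  (f g : V -> W) (x : V) :
  (\forall y \near x, f y = g y) -> differentiable f x -> differentiable g x.
Proof.
move=> fg df; have dfc := diff_continuous df.
have gE : g \o shift x = cst (g x) + 'd f x +o_ 0 id.
  apply/eqaddoP => e e0.
  have /eqaddoP /(_ _ e0) := diff_locally df.
  rewrite !near_simpl => le_f.
  have nU : \forall y \near (0 : V), f (y + x) = g (y + x).
    by move: fg; rewrite (near_shift 0) subr0.
  apply: filterS2 nU le_f => y fgy /=.
  by rewrite !fctE /shift /= fgy (nbhs_singleton fg).
apply/diff_locallyP; rewrite (diff_unique dfc gE); split => //.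
Qed.

Section SmoothFunctions.
Context {R : realType} (U : set (pt R)) (oU : open U).
Implicit Types (f g : pt R -> R) (a b : 'I_4) (x : pt R).

Lemma partial_eq_on f g a x : {in U, f =1 g} -> U x ->
  partial a f x = partial a g x.
Proof.
move=> fg Ux; apply: near_eq_derive.
by apply: filterS (open_nbhs_nbhs (conj oU Ux)) => y Uy; apply: fg; rewrite inE.
Qed.

Lemma smooth_differentiable f x : smooth_on U f -> U x -> differentiable f x.
Proof. by move=> sf; exact: (sf [::] x). Qed.

Lemma smooth_derivable f x v : smooth_on U f -> U x -> derivable f x v.
Proof. by move=> sf Ux; apply/diff_derivable/smooth_differentiable. Qed.

Lemma smooth_partial f a : smooth_on U f -> smooth_on U (partial a f).
Proof. by move=> sf l x Ux; rewrite -foldr_rcons; exact: sf. Qed.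

(** Smoothness truncated at order [n].  The product rule expresses a derivative of
    [f * g] of order [n + 1] by derivatives of order [n] of products, so closure
    properties are proved by induction on this order, not on the list of
    directions. *)
Definition differentiable_upto (n : nat) f :=
  forall (l : seq 'I_4) x, (size l <= n)%N -> U x ->
    differentiable (foldr (@partial R) f l) x.

Lemma differentiable_uptoS n f :
  (forall x, U x -> differentiable f x) ->
  (forall a, differentiable_upto n (partial a f)) ->
  differentiable_upto n.+1 f.
Proof.
move=> df dpf l x; case/lastP: l => [_|l a]; first exact: df.
by rewrite size_rcons foldr_rcons ltnS; exact: dpf.
Qed.

Lemma differentiable_upto_partial n f a :
  differentiable_upto n.+1 f -> differentiable_upto n (partial a f).
Proof.
by move=> df l x ln Ux; rewrite -foldr_rcons; apply: df; rewrite ?size_rcons.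
Qed.

Lemma differentiable_uptoW n f :
  differentiable_upto n.+1 f -> differentiable_upto n f.
Proof. by move=> df l x ln; apply: df; exact: leqW. Qed.

Lemma differentiable_upto0 n f x :
  differentiable_upto n f -> U x -> differentiable f x.
Proof. by move=> df Ux; exact: (df [::]). Qed.

Lemma smooth_upto f : smooth_on U f <-> forall n, differentiable_upto n f.
Proof.
split=> [sf n l x _|df l x]; first exact: sf.
exact: (df (size l) l x (leqnn _)).
Qed.

Lemma differentiable_eq_on f g x : {in U, f =1 g} -> U x ->
  differentiable f x -> differentiable g x.
Proof.
move=> fg Ux; apply: near_differentiable.
by apply: filterS (open_nbhs_nbhs (conj oU Ux)) => y Uy; apply: fg; rewrite inE.
Qed.

Lemma differentiable_upto_eq n f g : {in U, f =1 g} ->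
  differentiable_upto n f -> differentiable_upto n g.
Proof.
elim: n f g => [|n IH] f g fg df.
  move=> l x; rewrite leqn0 => /nilP -> Ux.
  exact: differentiable_eq_on fg Ux (differentiable_upto0 df Ux).
apply: differentiable_uptoS => [x Ux|a].
  exact: differentiable_eq_on fg Ux (differentiable_upto0 df Ux).
apply: IH (differentiable_upto_partial a df) => x.
by rewrite inE => Ux; exact: partial_eq_on.
Qed.

Lemma differentiable_upto_cst n (c : R) : differentiable_upto n (fun=> c).
Proof.
elim: n c => [|n IH] c.
  by move=> l x; rewrite leqn0 => /nilP -> _; exact: differentiable_cst.
apply: differentiable_uptoS => [x _|a]; first exact: differentiable_cst.
apply: differentiable_upto_eq (IH 0) => x _.
by rewrite /partial (derive_cst (W := R)).
Qed.

Lemma differentiable_uptoD n f g : differentiable_upto n f ->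
  differentiable_upto n g -> differentiable_upto n (fun x => f x + g x).
Proof.
elim: n f g => [|n IH] f g df dg.
  move=> l x; rewrite leqn0 => /nilP -> Ux.
  by apply: differentiableD; [exact: differentiable_upto0 df Ux|exact: differentiable_upto0 dg Ux].
apply: differentiable_uptoS => [x Ux|a].
  by apply: differentiableD; [exact: differentiable_upto0 df Ux|exact: differentiable_upto0 dg Ux].
apply: differentiable_upto_eq (IH (partial a f) (partial a g) _ _) => [x||].
- rewrite inE => Ux; rewrite /partial deriveD //; apply/diff_derivable.
  + exact: differentiable_upto0 df Ux.
  + exact: differentiable_upto0 dg Ux.
- exact: differentiable_upto_partial.
- exact: differentiable_upto_partial.
Qed.

Lemma differentiable_uptoM n f g : differentiable_upto n f ->
  differentiable_upto n g -> differentiable_upto n (fun x => f x * g x).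
Proof.
elim: n f g => [|n IH] f g df dg.
  move=> l x; rewrite leqn0 => /nilP -> Ux.
  by apply: differentiableM; [exact: differentiable_upto0 df Ux|exact: differentiable_upto0 dg Ux].
apply: differentiable_uptoS => [x Ux|a].
  by apply: differentiableM; [exact: differentiable_upto0 df Ux|exact: differentiable_upto0 dg Ux].
apply: (@differentiable_upto_eq _
  (fun x => f x * partial a g x + g x * partial a f x)).
  move=> x; rewrite inE => Ux; rewrite /partial deriveM //; apply/diff_derivable.
  + exact: differentiable_upto0 df Ux.
  + exact: differentiable_upto0 dg Ux.
apply: differentiable_uptoD; apply: IH; by
  [exact: differentiable_uptoW | exact: differentiable_upto_partial].
Qed.

Lemma differentiable_uptoV n f : (forall x, U x -> f x != 0) ->
  differentiable_upto n f -> differentiable_upto n (fun x => (f x)^-1).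
Proof.
move=> f0; elim: n => [|n IH] df.
  move=> l x; rewrite leqn0 => /nilP -> Ux.
  by apply: differentiableV; [exact: differentiable_upto0 df Ux|exact: f0].
apply: differentiable_uptoS => [x Ux|a].
  by apply: differentiableV; [exact: differentiable_upto0 df Ux|exact: f0].
apply: (@differentiable_upto_eq _
  (fun x => - 1 * ((f x)^-1 * (f x)^-1 * partial a f x))).
  move=> x; rewrite inE => Ux; rewrite /partial deriveV ?f0 //.
    rewrite mulN1r scaleNr; congr (- (_ * _)); by rewrite expr2 invfM.
  apply/diff_derivable; exact: differentiable_upto0 df Ux.
have dV := IH (differentiable_uptoW df).
apply: differentiable_uptoM; first exact: differentiable_upto_cst.
apply: differentiable_uptoM; first exact: differentiable_uptoM.
exact: differentiable_upto_partial.
Qed.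

Lemma smooth_eq_on f g : {in U, f =1 g} -> smooth_on U f -> smooth_on U g.
Proof.
move=> fg /smooth_upto sf; apply/smooth_upto => n.
exact: differentiable_upto_eq fg (sf n).
Qed.

Lemma smooth_cst (c : R) : smooth_on U (fun=> c).
Proof. by apply/smooth_upto => n; exact: differentiable_upto_cst. Qed.

Lemma smoothD f g : smooth_on U f -> smooth_on U g ->
  smooth_on U (fun x => f x + g x).
Proof.
move=> /smooth_upto sf /smooth_upto sg; apply/smooth_upto => n.
exact: differentiable_uptoD.
Qed.

Lemma smoothM f g : smooth_on U f -> smooth_on U g ->
  smooth_on U (fun x => f x * g x).
Proof.
move=> /smooth_upto sf /smooth_upto sg; apply/smooth_upto => n.
exact: differentiable_uptoM.
Qed.

Lemma smoothN f : smooth_on U f -> smooth_on U (fun x => - f x).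
Proof.
move=> sf; apply: smooth_eq_on (smoothM (smooth_cst (-1)) sf) => x _.
by rewrite mulN1r.
Qed.

Lemma smoothB f g : smooth_on U f -> smooth_on U g ->
  smooth_on U (fun x => f x - g x).
Proof. by move=> sf sg; apply: smoothD => //; exact: smoothN. Qed.

Lemma smoothV f : (forall x, U x -> f x != 0) -> smooth_on U f ->
  smooth_on U (fun x => (f x)^-1).
Proof.
move=> f0 /smooth_upto sf; apply/smooth_upto => n.
exact: differentiable_uptoV.
Qed.

Lemma smooth_sum (I : Type) (r : seq I) (F : I -> pt R -> R) :
  (forall i, smooth_on U (F i)) -> smooth_on U (fun x => \sum_(i <- r) F i x).
Proof.
move=> sF; elim: r => [|i r IH].
  by apply: smooth_eq_on (smooth_cst 0) => x _; rewrite big_nil.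
apply: smooth_eq_on (smoothD (sF i) IH) => x _; by rewrite big_cons.
Qed.

Lemma smooth_prod (I : Type) (r : seq I) (F : I -> pt R -> R) :
  (forall i, smooth_on U (F i)) -> smooth_on U (fun x => \prod_(i <- r) F i x).
Proof.
move=> sF; elim: r => [|i r IH].
  by apply: smooth_eq_on (smooth_cst 1) => x _; rewrite big_nil.
apply: smooth_eq_on (smoothM (sF i) IH) => x _; by rewrite big_cons.
Qed.

Lemma smooth_exprn f (n : nat) : smooth_on U f -> smooth_on U (fun x => f x ^+ n).
Proof.
move=> sf; elim: n => [|n IH].
  by apply: smooth_eq_on (smooth_cst 1) => x _; rewrite expr0.
by apply: smooth_eq_on (smoothM sf IH) => x _; rewrite exprS.
Qed.

Section PartialRules.
Variables (x : pt R) (Ux : U x).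

Lemma partial_cst a (c : R) y : partial a (fun=> c) y = 0.
Proof. by rewrite /partial (derive_cst (W := R)). Qed.

Lemma partialD a f g : smooth_on U f -> smooth_on U g ->
  partial a (fun y => f y + g y) x = partial a f x + partial a g x.
Proof. by move=> sf sg; rewrite /partial deriveD //; exact: smooth_derivable. Qed.

Lemma partialN a f : smooth_on U f ->
  partial a (fun y => - f y) x = - partial a f x.
Proof. by move=> sf; rewrite /partial deriveN //; exact: smooth_derivable. Qed.

Lemma partialB a f g : smooth_on U f -> smooth_on U g ->
  partial a (fun y => f y - g y) x = partial a f x - partial a g x.
Proof. by move=> sf sg; rewrite /partial deriveB //; exact: smooth_derivable. Qed.

Lemma partialM a f g : smooth_on U f -> smooth_on U g ->
  partial a (fun y => f y * g y) x = partial a f x * g x + f x * partial a g x.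
Proof.
move=> sf sg; rewrite /partial deriveM; last 2 first.
- exact: smooth_derivable.
- exact: smooth_derivable.
by rewrite /GRing.scale /= addrC [g x * _]mulrC.
Qed.

Lemma partialZ a (c : R) f : smooth_on U f ->
  partial a (fun y => c * f y) x = c * partial a f x.
Proof.
by move=> sf; rewrite partialM //; [rewrite partial_cst mul0r add0r|exact: smooth_cst].
Qed.

Lemma partial_sum (I : Type) (r : seq I) a (F : I -> pt R -> R) :
  (forall i, smooth_on U (F i)) ->
  partial a (fun y => \sum_(i <- r) F i y) x = \sum_(i <- r) partial a (F i) x.
Proof.
move=> sF; elim: r => [|i r IH].
  rewrite big_nil; apply: etrans (partial_cst a 0 x).
  apply: partial_eq_on => // y _; by rewrite big_nil.
rewrite big_cons -IH -partialD //; last exact: smooth_sum.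
by apply: partial_eq_on => // y _; rewrite big_cons.
Qed.

Lemma partial_comm a b f : smooth_on U f ->
  partial a (partial b f) x = partial b (partial a f) x.
Proof.
move=> sf; apply: derive_comm.
- apply: filterS (open_nbhs_nbhs (conj oU Ux)) => y Uy; split.
  + exact: smooth_differentiable sf Uy.
  + exact: (smooth_differentiable (smooth_partial a sf) Uy).
  + exact: (smooth_differentiable (smooth_partial b sf) Uy).
- apply: differentiable_continuous.
  exact: (smooth_differentiable (smooth_partial a (smooth_partial b sf)) Ux).
- apply: differentiable_continuous.
  exact: (smooth_differentiable (smooth_partial b (smooth_partial a sf)) Ux).
Qed.

End PartialRules.

End SmoothFunctions.

(** * Four indices and trace-free double bivectors *)

Definition i0 : 'I_4 := ord0.
Definition i1 : 'I_4 := lift ord0 ord0.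
Definition i2 : 'I_4 := lift ord0 (lift ord0 ord0).
Definition i3 : 'I_4 := lift ord0 (lift ord0 (lift ord0 ord0)).

Lemma sum4 (V : nmodType) (F : 'I_4 -> V) :
  \sum_i F i = F i0 + (F i1 + (F i2 + F i3)).
Proof. by rewrite !big_ord_recl big_ord0 addr0. Qed.

Lemma ord4_ind (P : 'I_4 -> Prop) : P i0 -> P i1 -> P i2 -> P i3 -> forall i, P i.
Proof.
move=> P0 P1 P2 P3 i.
case: (unliftP ord0 i) => [j ->|-> //]; case: (unliftP ord0 j) => [k ->|-> //].
by case: (unliftP ord0 k) => [l ->|-> //]; rewrite (ord1 l).
Qed.

Section Kronecker.
Context {R : realType}.

Lemma kronC (a b : 'I_4) : kron R a b = kron R b a.
Proof. by rewrite /kron eq_sym. Qed.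

Lemma sum_kron (a : 'I_4) (F : 'I_4 -> R) : \sum_b kron R a b * F b = F a.
Proof.
rewrite (bigD1 a) //= big1 => [|b ba]; first by rewrite /kron eqxx mul1r addr0.
by rewrite /kron eq_sym (negbTE ba) mul0r.
Qed.

Lemma sum_kronr (a : 'I_4) (F : 'I_4 -> R) : \sum_b F b * kron R b a = F a.
Proof. by rewrite -[RHS]sum_kron; apply: eq_bigr => b _; rewrite mulrC kronC. Qed.

Lemma kron_trace : \sum_b kron R b b = 4.
Proof. by rewrite sum4 /kron !eqxx /= mulr1n; ring. Qed.

End Kronecker.

Section TraceFreeDoubleBivector.
Context {R : realType}.
Variable W : 'I_4 -> 'I_4 -> 'I_4 -> 'I_4 -> R.
Hypothesis Wu : forall a b c d, W a b c d = - W b a c d.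
Hypothesis Wl : forall a b c d, W a b c d = - W a b d c.
Hypothesis Wtr : forall a c, \sum_b W a b c b = 0.

Let u0 a c d : W a a c d = 0.
Proof. by apply/eqP; rewrite -[_ == 0](mulrn_eq0 _ 2) mulr2n {1}Wu addNr. Qed.
Let l0 a b c : W a b c c = 0.
Proof. by apply/eqP; rewrite -[_ == 0](mulrn_eq0 _ 2) mulr2n {1}Wl addNr. Qed.
(* Brings each pair of indices into increasing order. *)
Let can :=
  (u0, l0, fun c d => Wu i1 i0 c d, fun c d => Wu i2 i0 c d,
   fun c d => Wu i3 i0 c d, fun c d => Wu i2 i1 c d,
   fun c d => Wu i3 i1 c d, fun c d => Wu i3 i2 c d,
   fun a b => Wl a b i1 i0, fun a b => Wl a b i2 i0,
   fun a b => Wl a b i3 i0, fun a b => Wl a b i2 i1,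
   fun a b => Wl a b i3 i1, fun a b => Wl a b i3 i2).

(** In dimension four a trace-free [W] has only 20 independent entries.  The
    equations [Wtr a c] with [a != c] have two terms each and identify entries up
    to sign; those with [a = c] give [W^01_01 = W^23_23] and its analogues
    (duality of complementary planes) and [W^01_01 + W^02_02 + W^03_03 = 0].  After
    this substitution both sides agree as polynomials for each [d] and [e]. *)
Lemma tracefree_square (d e : 'I_4) :
  4 * (\sum_a \sum_m \sum_p W m p d a * W e a m p) =
  kron R e d * \sum_a \sum_b \sum_c \sum_d W a b c d * W c d a b.
Proof.
have T a c : W a i0 c i0 + (W a i1 c i1 + (W a i2 c i2 + W a i3 c i3)) = 0.
  by rewrite -(Wtr a c) sum4.
have e0313 : W i0 i3 i1 i3 = - W i0 i2 i1 i2.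
  by move: (T i0 i1); rewrite !can => H; lra.
have e0323 : W i0 i3 i2 i3 = W i0 i1 i1 i2.
  by move: (T i0 i2); rewrite !can => H; lra.
have e0223 : W i0 i2 i2 i3 = - W i0 i1 i1 i3.
  by move: (T i0 i3); rewrite !can => H; lra.
have e1303 : W i1 i3 i0 i3 = - W i1 i2 i0 i2.
  by move: (T i1 i0); rewrite !can => H; lra.
have e1323 : W i1 i3 i2 i3 = - W i0 i1 i0 i2.
  by move: (T i1 i2); rewrite !can => H; lra.
have e1223 : W i1 i2 i2 i3 = W i0 i1 i0 i3.
  by move: (T i1 i3); rewrite !can => H; lra.
have e2303 : W i2 i3 i0 i3 = W i1 i2 i0 i1.
  by move: (T i2 i0); rewrite !can => H; lra.
have e2313 : W i2 i3 i1 i3 = - W i0 i2 i0 i1.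
  by move: (T i2 i1); rewrite !can => H; lra.
have e1213 : W i1 i2 i1 i3 = - W i0 i2 i0 i3.
  by move: (T i2 i3); rewrite !can => H; lra.
have e2302 : W i2 i3 i0 i2 = - W i1 i3 i0 i1.
  by move: (T i3 i0); rewrite !can => H; lra.
have e2312 : W i2 i3 i1 i2 = W i0 i3 i0 i1.
  by move: (T i3 i1); rewrite !can => H; lra.
have e1312 : W i1 i3 i1 i2 = - W i0 i3 i0 i2.
  by move: (T i3 i2); rewrite !can => H; lra.
have e0303 : W i0 i3 i0 i3 = - W i0 i1 i0 i1 - W i0 i2 i0 i2.
  by move: (T i0 i0); rewrite !can => H; lra.
have [e1212 e1313 e2323] : [/\ W i1 i2 i1 i2 = - W i0 i1 i0 i1 - W i0 i2 i0 i2,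
    W i1 i3 i1 i3 = W i0 i2 i0 i2 & W i2 i3 i2 i3 = W i0 i1 i0 i1].
  by move: (T i0 i0) (T i1 i1) (T i2 i2) (T i3 i3); rewrite !can => *; split; lra.
have pairs (X Y : 'I_4 -> 'I_4 -> R) : (forall m p, X m p = - X p m) ->
    (forall m p, Y m p = - Y p m) -> \sum_m \sum_p X m p * Y m p =
    2 * (X i0 i1 * Y i0 i1 + X i0 i2 * Y i0 i2 + X i0 i3 * Y i0 i3 +
         X i1 i2 * Y i1 i2 + X i1 i3 * Y i1 i3 + X i2 i3 * Y i2 i3).
  move=> aX aY; rewrite !sum4.
  rewrite (aX i1 i0) (aX i2 i0) (aX i3 i0) (aX i2 i1) (aX i3 i1) (aX i3 i2).
  rewrite (aY i1 i0) (aY i2 i0) (aY i3 i0) (aY i2 i1) (aY i3 i1) (aY i3 i2).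
  have d0 m : X m m = 0 by have := aX m m; lra.
  by rewrite !d0; ring.
under [in LHS]eq_bigr do rewrite pairs //.
elim/ord4_ind: d; elim/ord4_ind: e.
all: rewrite /kron /= ?mulr0n ?mulr1n ?mul0r ?mul1r.
all: try under [in RHS]eq_bigr do under eq_bigr do rewrite pairs //.
all: rewrite !sum4 !can; rewrite ?(e0313,e0323,e0223,e1303,e1323,e1223,e2303,e2313,e1213,e2302,e2312,e1312,e0303,e1212,e1313,e2323); ring.
Qed.
End TraceFreeDoubleBivector.

(** * Curvature and Weyl tensors as arrays *)

Definition ctr (R : realType) (F : 'I_4 -> R) : R := \sum_i F i.

Lemma ctrE (R : realType) (F : 'I_4 -> R) : \sum_i F i = ctr F.
Proof. by []. Qed.

(* Sums are generalized before a call to [ring], which would otherwise compare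
   their bodies up to unfolding. *)
Ltac sums_to_atoms := rewrite ?ctrE; repeat match goal with
  | |- context [@ctr ?R ?F] =>
      let X := fresh "X" in generalize (@ctr R F); intro X
  | |- context [@kron ?R ?a ?b] =>
      let X := fresh "X" in generalize (@kron R a b); intro X
  | |- context [bigop ?a ?b ?c] =>
      let X := fresh "X" in generalize (bigop a b c); intro X
  end.
Ltac sum_ring := sums_to_atoms; ring.
Ltac sum_field := sums_to_atoms; field.

Section ArrayCurvature.
Context {R : realType}.
Local Notation I := 'I_4.

Lemma sum_sumM (A : I -> R) (B : I -> I -> R) (C : I -> R) :
  \sum_e A e * (\sum_f B e f * C f) = \sum_f (\sum_e A e * B e f) * C f.
Proof.
under eq_bigr do rewrite mulr_sumr.
rewrite exchange_big; apply: eq_bigr => f _; rewrite mulr_suml.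
by apply: eq_bigr => e _; rewrite mulrA.
Qed.

Section Curv.
Variables (G : I -> I -> I -> R) (dG : I -> I -> I -> I -> R).
Hypothesis Gs : forall c a b, G c a b = G c b a.
Hypothesis dGs : forall l c a b, dG l c a b = dG l c b a.

(** The curvature [R_abc^d] in terms of the values [G c a b] of the Christoffel
    symbols and [dG l c a b] of their derivatives. *)
Definition curv a b c d : R :=
  - dG a d b c + dG b d a c
  + \sum_e G e a c * G d b e - \sum_e G e b c * G d a e.

Lemma curv_antisym a b c d : curv a b c d = - curv b a c d.
Proof. by rewrite /curv; sum_ring. Qed.

Lemma curv_bianchi a b c d : curv a b c d + curv b c a d + curv c a b d = 0.
Proof.
have sS i j k : \sum_e G e i j * G d k e = \sum_e G e j i * G d k e.
  by apply: eq_bigr => e _; rewrite Gs.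
rewrite /curv (dGs a d c b) (dGs b d a c) (dGs c d b a).
by rewrite (sS c a b) (sS c b a) (sS b a c); sum_ring.
Qed.

(* [h] stands for the metric, [dh] for its derivative, [F] for the Christoffel
   symbols of the first kind and [dF] for their derivative. *)
Variables (h : I -> I -> R) (dh : I -> I -> I -> R) (dF : I -> I -> I -> I -> R).
Hypothesis hs : forall a b, h a b = h b a.
Let F d a b := \sum_e h d e * G e a b.
Hypothesis dhE : forall l a b, dh l a b = F b l a + F a l b.
Hypothesis dFE : forall l d a b,
  dF l d a b = \sum_e (dh l d e * G e a b + h d e * dG l e a b).
Hypothesis ddh : forall k l c d,
  dF k d l c + dF k c l d = dF l d k c + dF l c k d.

Definition lower_last (T : I -> I -> I -> I -> R) a b c d := \sum_e T a b c e * h e d.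

(** Metric compatibility turns the derivatives of the metric, which arise when the
    index is lowered under the derivative, into products of Christoffel symbols. *)
Lemma lower_curvE a b c d : lower_last curv a b c d =
  - dF a d b c + dF b d a c
  + \sum_e F e a d * G e b c - \sum_e F e b d * G e a c.
Proof.
have H l i j : \sum_e h d e * dG l e i j =
    dF l d i j - \sum_e F e l d * G e i j - \sum_e F d l e * G e i j.
  rewrite dFE -!sumrB; apply: eq_bigr => e _.
  by rewrite dhE; ring.
have K l i j : \sum_e h d e * (\sum_f G f i j * G e l f) = \sum_f F d l f * G f i j.
  rewrite -sum_sumM; apply: eq_bigr => e _; congr (_ * _).
  by apply: eq_bigr => f _; rewrite mulrC.
have -> : lower_last curv a b c d = \sum_e h d e * curv a b c e.
  by apply: eq_bigr => e _; rewrite mulrC hs.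
have -> : \sum_e h d e * curv a b c e =
    - (\sum_e h d e * dG a e b c) + (\sum_e h d e * dG b e a c)
    + (\sum_e h d e * (\sum_f G f a c * G e b f))
    - (\sum_e h d e * (\sum_f G f b c * G e a f)).
  rewrite -sumrN -!big_split -sumrB; apply: eq_bigr => e _ /=.
  by rewrite /curv; sum_ring.
by rewrite !H !K; sum_ring.
Qed.

(** By [lower_curvE] the part symmetric in [c] and [d] is the commutator of two
    partial derivatives of [h c d], plus quadratic terms that cancel in pairs. *)
Lemma lower_curv_antisym a b c d :
  lower_last curv a b c d = - lower_last curv a b d c.
Proof.
apply/eqP; rewrite -addr_eq0; apply/eqP; rewrite !lower_curvE.
have ss k l i j : \sum_e F e k i * G e l j = \sum_e F e l j * G e k i.
  under eq_bigr do rewrite mulrC.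
  rewrite /F sum_sumM; apply: eq_bigr => e _; congr (_ * _).
  by apply: eq_bigr => f _; rewrite hs mulrC.
rewrite (ss a b c d) (ss b a c d).
have := ddh a b c d; sums_to_atoms.
move: (dF a d b c) (dF b d a c) (dF a c b d) (dF b c a d) => *.
lra.
Qed.

End Curv.

(** The four instances of the cyclic identity that omit one index in turn involve
    six entries up to sign; an alternating sum of them leaves twice the claim. *)
Lemma pair_symmetry (T : I -> I -> I -> I -> R) :
  (forall a b c d, T a b c d = - T b a c d) ->
  (forall a b c d, T a b c d = - T a b d c) ->
  (forall a b c d, T a b c d + T b c a d + T c a b d = 0) ->
  forall a b c d, T a b c d = T c d a b.
Proof.
move=> s1 s2 B a b c d.
have B1 := B a b c d; have B2 := B b c d a; have B3 := B c d a b; have B4 := B d a b c.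
move: B1 B2 B3 B4.
rewrite (s1 c a b d) (s2 b c d a) (s2 c d b a) (s1 d b c a) (s2 b d c a).
rewrite (s1 d a c b) (s2 a d c b) (s2 a c d b) (s1 d a b c) (s2 a b d c).
lra.
Qed.

Section Weyl.
Variables h hi : I -> I -> R.
Hypothesis hs : forall a b, h a b = h b a.
Hypothesis his : forall a b, hi a b = hi b a.
Hypothesis hhi : forall a c, \sum_b h a b * hi b c = kron R a c.
Local Notation low := (lower_last h).
Implicit Types (T C : I -> I -> I -> I -> R).

Lemma hih a c : \sum_b hi a b * h b c = kron R a c.
Proof. by rewrite kronC -hhi; apply: eq_bigr => b _; rewrite mulrC hs his. Qed.

Lemma raise_lower_sum (F : I -> R) a : \sum_b hi a b * (\sum_c h b c * F c) = F a.
Proof. by rewrite sum_sumM -[RHS]sum_kron; apply: eq_bigr => b _; rewrite hih. Qed.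

Lemma lower_raise_sum (F : I -> R) a : \sum_b h a b * (\sum_c hi b c * F c) = F a.
Proof. by rewrite sum_sumM -[RHS]sum_kron; apply: eq_bigr => b _; rewrite hhi. Qed.

Lemma raise_low T a b c d : \sum_e low T a b c e * hi e d = T a b c d.
Proof.
rewrite -[RHS](raise_lower_sum (T a b c)); apply: eq_bigr => e _.
rewrite mulrC his; congr (_ * _); apply: eq_bigr => f _.
by rewrite mulrC hs.
Qed.

(* The constructions of curvature tensors from the metric, on arrays: [T] takes
   the place of the Riemann tensor. *)
Definition ricciA T a c : R := \sum_b T a b c b.
Definition scalA T : R := \sum_a \sum_b hi a b * ricciA T a b.
Definition schA T a b : R := 2^-1 * (ricciA T a b - 6^-1 * scalA T * h a b).
Definition schmixA T d b : R := \sum_e hi d e * schA T e b.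
Definition weylA T a b c d : R :=
  T a b c d - (schmixA T d b * h a c - schmixA T d a * h b c)
  - (kron R d b * schA T a c - kron R d a * schA T b c).

Lemma schmix_trace T : \sum_b schmixA T b b = scalA T / 6.
Proof.
rewrite /schmixA /schA.
transitivity (\sum_b \sum_e (2^-1 * (hi b e * ricciA T b e)
    - 12^-1 * scalA T * (hi b e * h e b))).
  rewrite exchange_big; apply: eq_bigr => e _; apply: eq_bigr => b _.
  by rewrite his (hs b e); field.
under eq_bigr do rewrite sumrB -!mulr_sumr hih.
by rewrite sumrB -!mulr_sumr kron_trace -/(scalA T); field.
Qed.

Lemma sch_ricci T a c : ricciA T a c = 2 * schA T a c + scalA T / 6 * h a c.
Proof. by rewrite /schA; field. Qed.

Lemma lower_schmix T b d : \sum_e schmixA T e b * h e d = schA T d b.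
Proof.
rewrite -[RHS](lower_raise_sum (schA T ^~ b)); apply: eq_bigr => e _.
by rewrite mulrC hs.
Qed.

Lemma low_weylE T a b c d : low (weylA T) a b c d =
  low T a b c d - (schA T d b * h a c - schA T d a * h b c)
  - (h b d * schA T a c - h a d * schA T b c).
Proof.
have K i : \sum_e kron R e i * h e d = h i d.
  by under eq_bigr do rewrite kronC; rewrite sum_kron.
rewrite -(K b) -(K a) -(lower_schmix T b d) -(lower_schmix T a d) /lower_last.
rewrite !mulr_suml -!sumrB; apply: eq_bigr => e _.
by rewrite /weylA; ring.
Qed.

Section Symmetries.
Variable T : I -> I -> I -> I -> R.
Hypothesis T1 : forall a b c d, T a b c d = - T b a c d.
Hypothesis T2 : forall a b c d, low T a b c d = - low T a b d c.
Hypothesis T3 : forall a b c d, T a b c d + T b c a d + T c a b d = 0.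

Lemma low_antisym a b c d : low T a b c d = - low T b a c d.
Proof. by rewrite -sumrN; apply: eq_bigr => e _; rewrite T1 mulNr. Qed.

Lemma low_bianchi a b c d : low T a b c d + low T b c a d + low T c a b d = 0.
Proof.
by rewrite -!big_split big1 // => e _ /=; rewrite -!mulrDl T3 mul0r.
Qed.

(** Exchanging the two pairs of the lowered curvature exchanges the indices of its
    trace. *)
Lemma ricci_sym a c : ricciA T a c = ricciA T c a.
Proof.
have pair := pair_symmetry low_antisym T2 low_bianchi.
rewrite /ricciA.
under eq_bigr do rewrite -raise_low.
under [RHS]eq_bigr do rewrite -raise_low.
rewrite exchange_big; apply: eq_bigr => e _; apply: eq_bigr => b _.
by rewrite pair low_antisym T2 opprK his.
Qed.

Lemma sch_sym a b : schA T a b = schA T b a.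
Proof. by rewrite /schA ricci_sym hs. Qed.

Lemma weyl_trace a c : \sum_b weylA T a b c b = 0.
Proof.
transitivity (ricciA T a c - (scalA T / 6 * h a c - schA T a c)
   - (4 * schA T a c - schA T a c)).
  rewrite /weylA !sumrB -!mulr_suml schmix_trace kron_trace.
  by rewrite lower_schmix (sch_sym c) (eq_bigr _ (fun b _ => congr1 (fun k => k * _) (kronC b a))) sum_kron.
by rewrite sch_ricci; field.
Qed.

Lemma weyl_antisym a b c d : low (weylA T) a b c d = - low (weylA T) b a c d.
Proof. by rewrite !low_weylE low_antisym; ring. Qed.

Lemma weyl_antisym2 a b c d : low (weylA T) a b c d = - low (weylA T) a b d c.
Proof.
rewrite !low_weylE T2 (sch_sym d b) (sch_sym d a) (sch_sym c b) (sch_sym c a).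
by rewrite (hs b d) (hs b c) (hs a c) (hs a d); ring.
Qed.

Lemma weyl_pair a b c d : low (weylA T) a b c d = low (weylA T) c d a b.
Proof.
have pair := pair_symmetry low_antisym T2 low_bianchi.
rewrite !low_weylE pair (sch_sym d b) (sch_sym d a) (sch_sym c a).
by rewrite (hs c a) (hs d a) (hs d b) (hs c b); ring.
Qed.
End Symmetries.

Section Contraction.
Variable C : I -> I -> I -> I -> R.
Hypothesis C1 : forall a b c d, low C a b c d = - low C b a c d.
Hypothesis C2 : forall a b c d, low C a b c d = - low C a b d c.
Hypothesis C4 : forall a b c d, low C a b c d = low C c d a b.
Hypothesis Ctr : forall a c, \sum_b C a b c b = 0.

(** [C_d^amp]. *)
Definition up3A d a m p : R :=
  \sum_a' \sum_m' \sum_p' low C d a' m' p' * hi a' a * hi m' m * hi p' p.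
Definition sqA : R :=
  \sum_a \sum_b \sum_c \sum_d low C a b c d * \sum_a' hi a a' * up3A a' b c d.

(* [C_da^mp] *)
Let W m p d a := \sum_i \sum_j low C d a i j * hi i m * hi j p.

Let Wu a b c d : W a b c d = - W b a c d.
Proof.
rewrite /W exchange_big -sumrN; apply: eq_bigr => i _; rewrite -sumrN.
by apply: eq_bigr => j _; rewrite C2; ring.
Qed.

Let Wl a b c d : W a b c d = - W a b d c.
Proof.
rewrite /W -sumrN; apply: eq_bigr => i _; rewrite -sumrN.
by apply: eq_bigr => j _; rewrite C1; ring.
Qed.

Let Wtr a c : \sum_b W a b c b = 0.
Proof.
rewrite /W exchange_big big1 // => i _.
transitivity ((\sum_b C c b i b) * hi i a); last by rewrite Ctr mul0r.
rewrite mulr_suml; apply: eq_bigr => b _; rewrite -raise_low mulr_suml.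
by apply: eq_bigr => j _; ring.
Qed.

Let up3E d a m p : up3A d a m p = \sum_b hi b a * W m p d b.
Proof.
apply: eq_bigr => b _; rewrite /W mulr_sumr; apply: eq_bigr => i _.
by rewrite mulr_sumr; apply: eq_bigr => j _; ring.
Qed.

Let raiseC b m p e : \sum_a hi b a * C m p a e = W b e m p.
Proof.
apply: eq_bigr => i _; rewrite -raise_low mulr_sumr; apply: eq_bigr => j _.
by rewrite (his b i); ring.
Qed.

(** Pair symmetry is what allows the first two indices of [C_abcd C^abcd] to be
    raised in one factor and the last two in the other. *)
Lemma weyl_sq_trace :
  sqA = \sum_a \sum_b \sum_c \sum_d W a b c d * W c d a b.
Proof.
have swap (F : I -> I -> I -> I -> R) : \sum_a \sum_b \sum_c \sum_d F a b c d =
    \sum_c \sum_d \sum_a \sum_b F a b c d.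
  under eq_bigr do rewrite exchange_big.
  rewrite exchange_big; apply: eq_bigr => c _.
  under eq_bigr do rewrite exchange_big.
  by rewrite exchange_big.
rewrite /sqA swap; apply: eq_bigr => c _; apply: eq_bigr => d _.
transitivity (\sum_a \sum_b \sum_a' \sum_b'
    W c d a' b' * (low C a b c d * hi a a' * hi b' b)).
  apply: eq_bigr => a _; apply: eq_bigr => b _.
  rewrite mulr_sumr; apply: eq_bigr => a' _; rewrite up3E !mulr_sumr.
  by apply: eq_bigr => b' _; ring.
rewrite swap; apply: eq_bigr => a' _; apply: eq_bigr => b' _.
rewrite /(W a' b' c d) mulr_sumr; apply: eq_bigr => a _.
rewrite mulr_sumr; apply: eq_bigr => b _.
by rewrite C4 (his b' b).
Qed.

(** The contraction is [- W^mp_da W^ea_mp u_e], to which [tracefree_square]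
    applies.  The sign comes from exchanging [e] and [a] in the second factor. *)
Lemma weyl_contraction (u : I -> R) d :
  4 * (\sum_a \sum_m \sum_p up3A d a m p * \sum_e C m p a e * u e) = - sqA * u d.
Proof.
have bil (X Y : I -> R) (A B : I -> I -> R) :
    \sum_a (\sum_b A b a * X b) * (\sum_e B a e * Y e) =
    \sum_b \sum_e X b * Y e * (\sum_a A b a * B a e).
  transitivity (\sum_a \sum_b \sum_e X b * Y e * (A b a * B a e)).
    apply: eq_bigr => a _; rewrite mulr_suml; apply: eq_bigr => b _.
    by rewrite mulr_sumr; apply: eq_bigr => e _; ring.
  rewrite exchange_big; apply: eq_bigr => b _.
  rewrite exchange_big; apply: eq_bigr => e _.
  by rewrite mulr_sumr.
have rot (F : I -> I -> I -> I -> R) : \sum_m \sum_p \sum_b \sum_e F m p b e =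
    \sum_e \sum_b \sum_m \sum_p F m p b e.
  under eq_bigr do under eq_bigr do rewrite exchange_big.
  under eq_bigr do rewrite exchange_big.
  rewrite exchange_big; apply: eq_bigr => e _.
  under eq_bigr do rewrite exchange_big.
  by rewrite exchange_big.
rewrite weyl_sq_trace; set tr := (X in - X * _).
have -> : \sum_a \sum_m \sum_p up3A d a m p * (\sum_e C m p a e * u e) =
    \sum_e \sum_b \sum_m \sum_p W m p d b * u e * W b e m p.
  rewrite -rot exchange_big; apply: eq_bigr => m _.
  rewrite exchange_big; apply: eq_bigr => p _.
  under eq_bigr do rewrite up3E.
  rewrite bil; apply: eq_bigr => b _; apply: eq_bigr => e _.
  by rewrite raiseC.
transitivity (\sum_e kron R d e * (- tr * u e)); last by rewrite sum_kron.
rewrite mulr_sumr; apply: eq_bigr => e _.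
have TF := tracefree_square Wu Wl Wtr d e.
transitivity (- u e * (4 * (\sum_b \sum_m \sum_p W m p d b * W e b m p))).
  rewrite mulrCA !mulr_sumr; apply: eq_bigr => b _; rewrite !mulr_sumr.
  apply: eq_bigr => m _; rewrite !mulr_sumr; apply: eq_bigr => p _.
  by rewrite (Wu b e); ring.
by rewrite TF -/tr kronC; ring.
Qed.
End Contraction.
End Weyl.
End ArrayCurvature.

(** * Conformal change of arrays *)

Section ConformalChange.
Context {R : realType}.
Local Notation I := 'I_4.
Variables h hi : I -> I -> R.
Hypothesis hs : forall a b, h a b = h b a.
Hypothesis his : forall a b, hi a b = hi b a.
Hypothesis hhi : forall a c, \sum_b h a b * hi b c = kron R a c.

Section Curvature.
Variables (G : I -> I -> I -> R) (dG : I -> I -> I -> I -> R) (dh : I -> I -> I -> R).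
(* [u] is the logarithmic gradient of the conformal factor, [du] its derivative
   and [duu a d] the derivative of [u^d] in direction [a]. *)
Variables (u : I -> R) (du duu : I -> I -> R).
Hypothesis Gs : forall c a b, G c a b = G c b a.
Hypothesis dus : forall a b, du a b = du b a.

Definition hess a b : R := du a b - \sum_e G e a b * u e.
Definition raised_covector d : R := \sum_e hi d e * u e.
Local Notation uu := raised_covector.
Hypothesis duuE : forall a d, duu a d = \sum_e hi d e * hess a e - \sum_e G d a e * uu e.
Hypothesis dhE : forall l a b, dh l a b = \sum_e h b e * G e l a + \sum_e h a e * G e l b.

(** The difference of the two connections. *)
Definition Qconf c a b : R := - kron R c a * u b - kron R c b * u a + h a b * uu c.
Definition Gconf c a b : R := G c a b + Qconf c a b.
Definition dGconf l c a b : R := dG l c a b - kron R c a * du l b - kron R c b * du l a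
   + dh l a b * uu c + h a b * duu l c.
Definition norm2 : R := \sum_e uu e * u e.
(** The change of the Schouten tensor. *)
Definition Pconf a b : R := hess a b + u a * u b - 2^-1 * norm2 * h a b.
Definition Pmix d b : R := \sum_e hi d e * Pconf e b.

Lemma hess_sym a b : hess a b = hess b a.
Proof. by rewrite /hess dus; congr (_ - _); apply: eq_bigr => e _; rewrite Gs. Qed.

Lemma Pconf_sym a b : Pconf a b = Pconf b a.
Proof. by rewrite /Pconf hess_sym hs; ring. Qed.

Lemma lower_uu b : \sum_e h b e * uu e = u b.
Proof. exact: lower_raise_sum. Qed.

(** [Q] enters all later computations only through its contractions, in which the
    Kronecker deltas disappear. *)
Lemma sum_Q (X : I -> R) a c :
  \sum_e Qconf e a c * X e = - u c * X a - u a * X c + h a c * \sum_e uu e * X e.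
Proof.
rewrite -[X a in RHS]sum_kron -[X c in RHS]sum_kron !mulr_sumr -sumrB -big_split.
apply: eq_bigr => e _ /=.
by rewrite /Qconf (kronC e a) (kronC e c); move: (uu e) => ue; ring.
Qed.

Lemma Gconf_sym c a b : Gconf c a b = Gconf c b a.
Proof. by rewrite /Gconf /Qconf Gs hs; move: (uu _) => ?; ring. Qed.

Lemma PmixE d b :
  Pmix d b = \sum_e hi d e * hess b e + uu d * u b - 2^-1 * norm2 * kron R d b.
Proof.
rewrite -(hih hs his hhi) /Pmix /uu mulr_suml mulr_sumr -big_split -sumrB.
by apply: eq_bigr => e _ /=; rewrite (hess_sym b) /Pconf; ring.
Qed.

(** [R(G + Q) = R(G) - nabla_a Q_b + nabla_b Q_a + [Q, Q]].  The derivative terms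
    contribute the Hessian of [u] and the commutator the quadratic part of [P]. *)
Lemma curv_conformal a b c d :
  curv Gconf dGconf a b c d = curv G dG a b c d
  + kron R d b * Pconf a c - kron R d a * Pconf b c
  + h a c * Pmix d b - h b c * Pmix d a.
Proof.
have GQ i j k : \sum_e G e i j * Qconf d k e =
    - kron R d k * (\sum_e G e i j * u e) - G d i j * u k
    + uu d * (\sum_e h k e * G e i j).
  rewrite -(sum_kron d (fun e => G e i j)) mulr_suml !mulr_sumr -sumrB -big_split.
  by apply: eq_bigr => e _ /=; rewrite /Qconf; move: (uu d) => x; ring.
have uQ k : \sum_e uu e * Qconf d k e = - (kron R d k * norm2).
  transitivity (- kron R d k * norm2 - (\sum_e kron R d e * uu e) * u k
     + (\sum_e h k e * uu e) * uu d).
    rewrite /norm2 !mulr_suml mulr_sumr -sumrB -big_split.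
    by apply: eq_bigr => e _ /=; rewrite /Qconf; move: (uu d) (uu e) => x y; ring.
  by rewrite sum_kron lower_uu; move: (uu d) => x; ring.
have GG i j k : \sum_e Gconf e i j * Gconf d k e =
    \sum_e G e i j * G d k e
    + (- kron R d k * (\sum_e G e i j * u e) - G d i j * u k
      + uu d * (\sum_e h k e * G e i j))
    + (- u j * Gconf d k i - u i * Gconf d k j
       + h i j * (\sum_e G d k e * uu e - kron R d k * norm2)).
  rewrite -GQ -(uQ k).
  have -> : \sum_e G d k e * uu e + \sum_e uu e * Qconf d k e =
      \sum_e uu e * Gconf d k e.
    by rewrite -big_split; apply: eq_bigr => e _; rewrite /Gconf /=; ring.
  rewrite -sum_Q -!big_split; apply: eq_bigr => e _ /=.
  by rewrite /Gconf; ring.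
rewrite /curv !GG !PmixE /dGconf !duuE !dhE /Pconf /hess (dus b a).
rewrite /Gconf /Qconf (Gs d b a).
rewrite (hs b a).
have -> : \sum_e h c e * G e b a = \sum_e h c e * G e a b.
  by apply: eq_bigr => e _; rewrite Gs.
move: (uu d) norm2 => x y.
by sum_field.
Qed.


(* [ddu m p a] is the second derivative of [u_a] in directions [m] and [p]. *)
Variable ddu : I -> I -> I -> R.

(** The covariant derivative [nabla_m S_pa] of a bilinear form [S] with partial
    derivatives [dS]. *)
Definition nabla2 (Ga : I -> I -> I -> R) (dS : I -> I -> I -> R) (S : I -> I -> R) m p a : R :=
  dS m p a - \sum_e Ga e m p * S e a - \sum_e Ga e m a * S p e.

Lemma nabla2D Ga dS dS' S S' m p a :
  nabla2 Ga (fun m p a => dS m p a + dS' m p a) (fun p a => S p a + S' p a) m p a =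
  nabla2 Ga dS S m p a + nabla2 Ga dS' S' m p a.
Proof.
rewrite /nabla2.
have E (X : I -> R) (Y Y' : I -> R) : \sum_e X e * (Y e + Y' e) =
    \sum_e X e * Y e + \sum_e X e * Y' e.
  by rewrite -big_split; apply: eq_bigr => e _; rewrite mulrDr.
by rewrite !E; sum_ring.
Qed.

(** The second derivatives of [u] are symmetric, and the terms in first
    derivatives of [u] cancel against those of [hess]. *)
Lemma ricci_identity m p a :
  (forall m p a, ddu m p a = ddu p m a) ->
  let dH m p a := ddu m p a - \sum_e (dG m e p a * u e + G e p a * du m e) in
  nabla2 G dH hess m p a - nabla2 G dH hess p m a = \sum_d curv G dG m p a d * u d.
Proof.
move=> ddus dH.
have cE i j : \sum_d (- dG i d j a * u d) + \sum_d (\sum_e G e i a * G d j e) * u d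
   = - \sum_d dG i d j a * u d + \sum_e G e i a * \sum_d G d j e * u d.
  by rewrite sum_sumM; congr (_ + _); rewrite -sumrN; apply: eq_bigr => e _; rewrite mulNr.
have -> : \sum_d curv G dG m p a d * u d =
    (\sum_d (- dG m d p a * u d) + \sum_d (\sum_e G e m a * G d p e) * u d)
    - (\sum_d (- dG p d m a * u d) + \sum_d (\sum_e G e p a * G d m e) * u d).
  by rewrite -!big_split -sumrB; apply: eq_bigr => e _ /=; rewrite /curv; sum_ring.
have GH i j : \sum_e G e i a * hess j e =
    \sum_e G e i a * du j e - \sum_e G e i a * \sum_d G d j e * u d.
  by rewrite -sumrB; apply: eq_bigr => e _; rewrite /hess mulrBr.
have GS : \sum_e G e p m * hess e a = \sum_e G e m p * hess e a.
  by apply: eq_bigr => e _; rewrite Gs.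
rewrite !cE /nabla2 /dH (ddus p m) !big_split /= !GH GS.
by sum_ring.
Qed.

(** Antisymmetrizing in [m] and [p] kills the contribution of the symmetric
    difference [Q^e_mp], so that only [Q^e_ma S_pe] remains. *)
Lemma nabla2_Gconf_antisym dS S m p a : (forall a b, S a b = S b a) ->
  nabla2 Gconf dS S m p a - nabla2 Gconf dS S p m a =
  nabla2 G dS S m p a - nabla2 G dS S p m a
  + u m * S p a - u p * S m a
  - h m a * (\sum_e uu e * S p e) + h p a * (\sum_e uu e * S m e).
Proof.
move=> Ss.
have GS : \sum_e Gconf e p m * S e a = \sum_e Gconf e m p * S e a.
  by apply: eq_bigr => e _; rewrite Gconf_sym.
have GS' : \sum_e G e p m * S e a = \sum_e G e m p * S e a.
  by apply: eq_bigr => e _; rewrite Gs.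
have QS i j : \sum_e Gconf e i a * S j e = \sum_e G e i a * S j e
    + (- u a * S j i - u i * S j a + h i a * \sum_e uu e * S j e).
  by rewrite -sum_Q -big_split; apply: eq_bigr => e _; rewrite /= -mulrDl.
by rewrite /nabla2 GS GS' !QS (Ss p m); sum_ring.
Qed.

Definition dhess m p a : R := ddu m p a - \sum_e (dG m e p a * u e + G e p a * du m e).
Definition dnorm2 m : R := \sum_e (duu m e * u e + uu e * du m e).
(** The product rule for the derivative of [Pconf p a] in direction [m]. *)
Definition dPconf m p a : R := dhess m p a + (du m p * u a + u p * du m a)
  - 2^-1 * (dnorm2 m * h p a + norm2 * dh m p a).

Lemma dnorm2E m : dnorm2 m = 2 * \sum_e uu e * hess m e.
Proof.
rewrite /dnorm2 big_split /=.
have -> : \sum_e duu m e * u e =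
    \sum_e uu e * hess m e - \sum_e (\sum_f G f m e * u f) * uu e.
  under eq_bigr do rewrite duuE mulrBl.
  rewrite sumrB; congr (_ - _).
    under [RHS]eq_bigr do rewrite /uu mulr_suml.
    rewrite exchange_big; apply: eq_bigr => e _ /=; rewrite mulr_suml.
    by apply: eq_bigr => f _; rewrite his; ring.
  under eq_bigr do rewrite mulr_suml.
  rewrite exchange_big; apply: eq_bigr => f _; rewrite mulr_suml.
  by apply: eq_bigr => e _; move: (uu f) => y; ring.
have -> : \sum_e uu e * du m e =
    \sum_e uu e * hess m e + \sum_e (\sum_f G f m e * u f) * uu e.
  rewrite -big_split; apply: eq_bigr => e _ /=; rewrite /hess.
  by move: (uu e) => y; sum_ring.
by sum_ring.
Qed.

Lemma nabla2_Pconf m p a :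
  (forall m p a, ddu m p a = ddu p m a) ->
  nabla2 G dPconf Pconf m p a - nabla2 G dPconf Pconf p m a =
  \sum_d curv G dG m p a d * u d
  + u p * hess m a - u m * hess p a
  - h p a * (\sum_e uu e * hess m e) + h m a * (\sum_e uu e * hess p e).
Proof.
move=> ddus; rewrite -ricci_identity //.
have E i j : nabla2 G dPconf Pconf i j a = nabla2 G dhess hess i j a +
    (hess i j * u a + u j * hess i a) - h j a * (\sum_e uu e * hess i e).
  rewrite /nabla2 /dPconf dnorm2E dhE.
  have -> : \sum_e G e i j * Pconf e a = \sum_e G e i j * hess e a
      + (\sum_e G e i j * u e) * u a
      - 2^-1 * norm2 * \sum_e h a e * G e i j.
    rewrite mulr_suml mulr_sumr -big_split -sumrB; apply: eq_bigr => e _ /=.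
    by rewrite /Pconf (hs e a); ring.
  have -> : \sum_e G e i a * Pconf j e = \sum_e G e i a * hess j e
      + (\sum_e G e i a * u e) * u j
      - 2^-1 * norm2 * \sum_e h j e * G e i a.
    rewrite mulr_suml mulr_sumr -big_split -sumrB; apply: eq_bigr => e _ /=.
    by rewrite /Pconf; ring.
  have duE k l : du k l = hess k l + \sum_e G e k l * u e by rewrite /hess subrK.
  rewrite (duE i j) (duE i a).
  by move: norm2 (dhess i j a) (hess i j) (hess i a) => x y z t; sum_field.
rewrite !E (hess_sym p m) -!/(dhess _ _ _).
move: (nabla2 _ _ _ _ _ _) (nabla2 _ _ _ p _ _) => x y.
by sum_ring.
Qed.

(** The contributions of [P] that do not contain [L] or the curvature cancel: those
    of [nabla2_Pconf] against those of [nabla2_Gconf_antisym] with [S = P].  The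
    terms in [L] are exactly the trace part by which the curvature exceeds the
    Weyl tensor, see [sum_weyl_covector]. *)
Lemma cotton_conformal L dL m p a :
  (forall a b, L a b = L b a) -> (forall m p a, ddu m p a = ddu p m a) ->
  let dLt m p a := dL m p a + dPconf m p a in
  let Lt p a := L p a + Pconf p a in
  nabla2 Gconf dLt Lt m p a - nabla2 Gconf dLt Lt p m a =
  nabla2 G dL L m p a - nabla2 G dL L p m a
  + \sum_d curv G dG m p a d * u d
  - ((\sum_e uu e * L p e) * h m a - (\sum_e uu e * L m e) * h p a)
  - (u p * L m a - u m * L p a).
Proof.
move=> Ls ddus dLt Lt.
rewrite nabla2_Gconf_antisym; last by move=> i j; rewrite /Lt Ls Pconf_sym.
have D i j : nabla2 G dLt Lt i j a = nabla2 G dL L i j a + nabla2 G dPconf Pconf i j a.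
  exact: nabla2D.
rewrite !D.
have uP i : \sum_e uu e * Lt i e = \sum_e uu e * L i e + \sum_e uu e * hess i e
    + 2^-1 * norm2 * u i.
  transitivity (\sum_e uu e * L i e + \sum_e uu e * hess i e
    + norm2 * u i - 2^-1 * norm2 * \sum_e h i e * uu e).
    rewrite {1}/norm2 mulr_suml mulr_sumr -!big_split -sumrB.
    by apply: eq_bigr => e _ /=; rewrite /Lt /Pconf; move: (uu e) => x; ring.
  by rewrite lower_uu; move: norm2 => x; sum_field.
rewrite !uP (canRL (subrK _) (nabla2_Pconf m p a ddus)).
rewrite /Lt /Pconf; move: norm2 (nabla2 _ _ _ _ _ _) (nabla2 _ _ _ _ _ _) => x y z.
move: (nabla2 _ _ _ _ _ _) => w.
by sum_field.
Qed.

End Curvature.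

Lemma sum_weyl_covector T (u : I -> R) m p a :
  (forall a b, schA h hi T a b = schA h hi T b a) ->
  \sum_e weylA h hi T m p a e * u e =
  \sum_e T m p a e * u e
  - ((\sum_e raised_covector u e * schA h hi T p e) * h m a
     - (\sum_e raised_covector u e * schA h hi T m e) * h p a)
  - (u p * schA h hi T m a - u m * schA h hi T p a).
Proof.
move=> Ls.
have mE i : \sum_e raised_covector u e * schA h hi T i e =
    \sum_d schmixA h hi T d i * u d.
  rewrite /raised_covector /schmixA.
  under eq_bigr do rewrite mulr_suml.
  rewrite exchange_big; apply: eq_bigr => d _; rewrite mulr_suml.
  by apply: eq_bigr => e _; rewrite his (Ls i e); ring.
rewrite !mE -[u p in RHS]sum_kron -[u m in RHS]sum_kron !mulr_suml -!sumrB.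
apply: eq_bigr => e _; rewrite /weylA (kronC p e) (kronC m e).
by move: (schmixA _ _ _ _ _) (schmixA _ _ _ _ _) (schA _ _ _ _ _) (schA _ _ _ _ _) => *; ring.
Qed.

Variable t : R.
Hypothesis t0 : t != 0.
(* [t] is the square of the conformal factor. *)
Definition scaled_lower a b : R := t^-1 * h a b.
Definition scaled_upper a b : R := t * hi a b.
Local Notation ht := scaled_lower.
Local Notation hti := scaled_upper.

Section WeylInvariance.
Variables (T Tt : I -> I -> I -> I -> R) (P : I -> I -> R).
Hypothesis Ps : forall a b, P a b = P b a.
Let Pm d b := \sum_e hi d e * P e b.
Hypothesis TtE : forall a b c d, Tt a b c d = T a b c d
  + kron R d b * P a c - kron R d a * P b c + h a c * Pm d b - h b c * Pm d a.

Let p := \sum_b Pm b b.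

Lemma ricci_conformal a c :
  ricciA Tt a c = ricciA T a c + 2 * P a c + h a c * p.
Proof.
have hP : \sum_b h b c * Pm b a = P a c.
  under eq_bigr do rewrite hs.
  by rewrite (lower_raise_sum hhi (P ^~ a)) Ps.
transitivity (\sum_b T a b c b + (\sum_b kron R b b) * P a c
    - \sum_b kron R a b * P b c + h a c * p - \sum_b h b c * Pm b a).
  rewrite /p mulr_suml mulr_sumr -!big_split -!sumrB -big_split -sumrB.
  by apply: eq_bigr => b _ /=; rewrite TtE (kronC a).
by rewrite kron_trace sum_kron hP /ricciA; sum_ring.
Qed.

Lemma scal_conformal : scalA hti Tt = t * (scalA hi T + 6 * p).
Proof.
have hP : p = \sum_a \sum_b hi a b * P a b.
  by apply: eq_bigr => a _; apply: eq_bigr => b _; rewrite Ps.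
have hh : \sum_a \sum_b hi a b * h a b = 4.
  rewrite -(kron_trace (R := R)); apply: eq_bigr => a _.
  by rewrite -(hih hs his hhi); apply: eq_bigr => b _; rewrite hs.
transitivity (t * (scalA hi T + 2 * p + (\sum_a \sum_b hi a b * h a b) * p)).
  rewrite {1}hP /scalA mulr_suml mulr_sumr -!big_split mulr_sumr.
  apply: eq_bigr => a _ /=; rewrite mulr_suml mulr_sumr -!big_split mulr_sumr.
  apply: eq_bigr => b _ /=; rewrite ricci_conformal /hti.
  by move: p => x; ring.
by rewrite hh; ring.
Qed.

(** The Ricci tensor changes by [2 P] plus a multiple of the metric; the factors in
    the Schouten tensor are chosen so that the multiple of the metric drops out. *)
Lemma sch_conformal a b : schA ht hti Tt a b = schA h hi T a b + P a b.
Proof.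
rewrite /schA scal_conformal ricci_conformal /ht; move: p (scalA _ _) => x y.
by field.
Qed.

(** The change of the curvature has the same form in [P] as the trace part of the
    curvature has in the Schouten tensor. *)
Lemma weyl_conformal a b c d : weylA ht hti Tt a b c d = weylA h hi T a b c d.
Proof.
have mE i j : schmixA ht hti Tt i j = t * (schmixA h hi T i j + Pm i j).
  rewrite /schmixA /Pm -big_split mulr_sumr; apply: eq_bigr => e _ /=.
  by rewrite sch_conformal /hti; ring.
rewrite /weylA !mE !sch_conformal TtE /ht.
move: (schmixA _ _ _ d b) (schmixA _ _ _ d a) (Pm d b) (Pm d a) => x y z w.
by field.
Qed.

End WeylInvariance.

Definition lambdaA (h0 hi0 : I -> I -> R) (C : I -> I -> I -> I -> R)
    (N : I -> I -> I -> R) d : R :=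
  8 * (\sum_a \sum_m \sum_p up3A h0 hi0 C d a m p * (2^-1 * (N m p a - N p m a)))
  / sqA h0 hi0 C.

Section Lambda.
Variable C : I -> I -> I -> I -> R.

Lemma low_scaled a b c d : lower_last ht C a b c d = t^-1 * lower_last h C a b c d.
Proof. by rewrite /lower_last mulr_sumr; apply: eq_bigr => e _; rewrite /ht; ring. Qed.

Lemma up3_scaled d a m p : up3A ht hti C d a m p = t ^+ 2 * up3A h hi C d a m p.
Proof.
rewrite /up3A mulr_sumr; apply: eq_bigr => i _; rewrite mulr_sumr.
apply: eq_bigr => j _; rewrite mulr_sumr; apply: eq_bigr => k _.
by rewrite low_scaled /hti; move: (lower_last _ _ _ _ _ _) => x; field.
Qed.

Lemma sq_scaled : sqA ht hti C = t ^+ 2 * sqA h hi C.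
Proof.
rewrite /sqA mulr_sumr; apply: eq_bigr => a _; rewrite mulr_sumr.
apply: eq_bigr => b _; rewrite mulr_sumr; apply: eq_bigr => c _.
rewrite mulr_sumr; apply: eq_bigr => d _; rewrite low_scaled.
have -> : \sum_e hti a e * up3A ht hti C e b c d =
    t ^+ 3 * \sum_e hi a e * up3A h hi C e b c d.
  rewrite mulr_sumr; apply: eq_bigr => e _.
  by rewrite up3_scaled /hti; move: (up3A _ _ _ _ _ _ _) => x; ring.
by rewrite ctrE; move: (ctr _) (lower_last _ _ _ _ _ _) => x y; field.
Qed.

Hypothesis C1 : forall a b c d, lower_last h C a b c d = - lower_last h C b a c d.
Hypothesis C2 : forall a b c d, lower_last h C a b c d = - lower_last h C a b d c.
Hypothesis C4 : forall a b c d, lower_last h C a b c d = lower_last h C c d a b.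
Hypothesis Ctr : forall a c, \sum_b C a b c b = 0.
Variables (N Nt : I -> I -> I -> R) (u : I -> R).
Hypothesis NtE : forall m p a,
  Nt m p a - Nt p m a = N m p a - N p m a + \sum_e C m p a e * u e.

(** All powers of [t] cancel between numerator and denominator, since
    [C_d^amp] and [C.C] scale in the same way; the shift comes from
    [weyl_contraction]. *)
Lemma lambda_conformal d : sqA h hi C != 0 ->
  lambdaA ht hti C Nt d = lambdaA h hi C N d - u d.
Proof.
move=> sq0; rewrite /lambdaA sq_scaled.
have -> : \sum_a \sum_m \sum_p up3A ht hti C d a m p * (2^-1 * (Nt m p a - Nt p m a)) =
    t ^+ 2 * (\sum_a \sum_m \sum_p up3A h hi C d a m p * (2^-1 * (N m p a - N p m a)))
    + t ^+ 2 * 2^-1 * (\sum_a \sum_m \sum_p up3A h hi C d a m p * \sum_e C m p a e * u e).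
  rewrite !mulr_sumr -big_split; apply: eq_bigr => a _ /=.
  rewrite !mulr_sumr -big_split; apply: eq_bigr => m _ /=.
  rewrite !mulr_sumr -big_split; apply: eq_bigr => p _ /=.
  by rewrite up3_scaled NtE; move: (up3A _ _ _ _ _ _ _) => x; sum_ring.
have E := weyl_contraction hs his hhi C1 C2 C4 Ctr u d.
have -> : \sum_a \sum_m \sum_p up3A h hi C d a m p * (\sum_e C m p a e * u e) =
    - sqA h hi C * u d / 4 by rewrite -E mulrAC mulfV ?mul1r.
move: sq0; move: (sqA _ _ _) => x x0; rewrite ctrE; move: (ctr _) => y.
by field; rewrite x0 t0.
Qed.

End Lambda.
End ConformalChange.

(** * The Levi-Civita connection in a chart *)

Section IndexTuples.
Context {R : realType} (g : comps R 0 2).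

Lemma nabla_covector (w : comps R 0 1) a b x :
  nabla g w [tuple] [tuple a; b] x =
  partial a (w [tuple] [tuple b]) x
  - \sum_e christoffel g e a b x * w [tuple] [tuple e] x.
Proof.
have E : [tuple of behead [tuple a; b]] = [tuple b] by apply: val_inj.
rewrite /nabla E big_ord0 addr0 big_ord1; congr (_ - _).
apply: eq_bigr => e _; congr (_ * w _ _ _).
by apply: eq_from_tnth => i; rewrite (ord1 i) tnth_mktuple.
Qed.

Lemma nabla_bilinear (T : comps R 0 2) a b c x :
  nabla g T [tuple] [tuple a; b; c] x =
  partial a (T [tuple] [tuple b; c]) x
  - \sum_e christoffel g e a b x * T [tuple] [tuple e; c] x
  - \sum_e christoffel g e a c x * T [tuple] [tuple b; e] x.
Proof.
have E : [tuple of behead [tuple a; b; c]] = [tuple b; c] by apply: val_inj.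
rewrite /nabla E big_ord0 addr0 big_ord_recl big_ord1 opprD addrA.
congr (_ - _ - _); apply: eq_bigr => e _; congr (_ * T _ _ _);
  apply: eq_from_tnth => i; rewrite tnth_mktuple;
  by case: (unliftP ord0 i) => [j ->|-> //]; rewrite (ord1 j).
Qed.

End IndexTuples.

Section LeviCivita.
Context {R : realType} (U : set (pt R)) (oU : open U).
Variables (g : comps R 0 2) (mg : metric_on U g).
Implicit Types (a b c d e f : 'I_4) (x : pt R).

Lemma gloE a b x : glo g a b x = g [tuple] [tuple a; b] x.
Proof. by rewrite /glo mxE. Qed.

Lemma smooth_glo a b : smooth_on U (glo g a b).
Proof. by apply: smooth_eq_on (mg.1 [tuple] [tuple a; b]) => // x _; rewrite gloE. Qed.

Lemma glo_sym a b x : U x -> glo g a b x = glo g b a x.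
Proof. by move=> Ux; rewrite /glo -[in LHS](mg.2 x Ux).1 mxE. Qed.

Lemma gup_sym a b x : U x -> gup g a b x = gup g b a x.
Proof. by move=> Ux; rewrite /gup -[in LHS](mg.2 x Ux).1 -trmx_inv mxE. Qed.

Lemma gup_glo a c x : U x -> \sum_b gup g a b x * glo g b c x = kron R a c.
Proof.
move=> Ux; have /matrixP /(_ a c) := mulVmx (mg.2 x Ux).2.
by rewrite !mxE.
Qed.

Lemma glo_gup a c x : U x -> \sum_b glo g a b x * gup g b c x = kron R a c.
Proof.
move=> Ux; have /matrixP /(_ a c) := mulmxV (mg.2 x Ux).2.
by rewrite !mxE.
Qed.

Lemma lower_raise (F : 'I_4 -> R) a x : U x ->
  \sum_b glo g a b x * (\sum_c gup g b c x * F c) = F a.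
Proof.
move=> Ux; pose h a b := glo g a b x; pose hi a b := gup g a b x.
exact: (lower_raise_sum (h := h) (hi := hi) (fun a c => glo_gup a c Ux)).
Qed.

Lemma raise_lower (F : 'I_4 -> R) a x : U x ->
  \sum_b gup g a b x * (\sum_c glo g b c x * F c) = F a.
Proof.
move=> Ux; pose h a b := glo g a b x; pose hi a b := gup g a b x.
exact: (raise_lower_sum (h := h) (hi := hi) (fun a b => glo_sym a b Ux)
  (fun a b => gup_sym a b Ux) (fun a c => glo_gup a c Ux)).
Qed.

Lemma smooth_det n (A : 'I_n -> 'I_n -> pt R -> R) :
  (forall i j, smooth_on U (A i j)) ->
  smooth_on U (fun x => \det (\matrix_(i, j) A i j x)).
Proof.
move=> sA; rewrite /determinant.
apply: (smooth_sum oU) => s; apply: (smoothM oU); first exact: smooth_cst.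
have sP := smooth_prod oU (index_enum 'I_n) (fun i => sA i (perm.fun_of_perm s i)).
apply: (smooth_eq_on oU _ sP) => x _.
by apply: eq_bigr => i _; rewrite mxE.
Qed.

(** By Cramer's rule the inverse matrix is a rational expression in the entries. *)
Lemma smooth_gup a b : smooth_on U (gup g a b).
Proof.
pose D x := \det (\matrix_(i, j) glo g i j x).
have DE x : D x = \det (gmx g x).
  by congr (\det _); apply/matrixP => i j; rewrite mxE.
have sD : smooth_on U D by apply: smooth_det => i j; exact: smooth_glo.
pose C x := (-1) ^+ (b + a) *
  \det (\matrix_(i < 3, j < 3) glo g (lift b i) (lift a j) x).
have sC : smooth_on U C.
  apply: (smoothM oU); first exact: smooth_cst.
  by apply: smooth_det => i j; exact: smooth_glo.
have D0 x : U x -> D x != 0.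
  by move=> Ux; rewrite DE -unitfE; exact: (mg.2 x Ux).2.
apply: (smooth_eq_on oU _ (smoothM oU (smoothV oU D0 sD) sC)) => x.
rewrite inE => Ux; rewrite /gup /invmx (mg.2 x Ux).2 mxE DE; congr (_ * _).
rewrite mxE /cofactor /C; congr (_ * \det _).
by apply/matrixP => i j; rewrite !mxE gloE.
Qed.

Lemma smooth_christoffel c a b : smooth_on U (christoffel g c a b).
Proof.
apply: (smoothM oU); first exact: smooth_cst.
apply: (smooth_sum oU) => d; apply: (smoothM oU); first exact: smooth_gup.
apply: (smoothB oU); first apply: (smoothD oU);
  by apply: smooth_partial; exact: smooth_glo.
Qed.

Lemma partial_glo_sym c a b x : U x ->
  partial c (glo g a b) x = partial c (glo g b a) x.
Proof.
move=> Ux; apply: (partial_eq_on oU) => // y; rewrite inE => Uy.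
exact: glo_sym.
Qed.

Lemma christoffel_sym c a b x : U x ->
  christoffel g c a b x = christoffel g c b a x.
Proof.
move=> Ux; congr (_ * _); apply: eq_bigr => d _; congr (_ * _).
by rewrite (partial_glo_sym d a b Ux) [partial a _ _ + _]addrC.
Qed.

Lemma christoffel_lo d a b x : U x ->
  \sum_e glo g d e x * christoffel g e a b x =
  2^-1 * (partial a (glo g b d) x + partial b (glo g a d) x - partial d (glo g a b) x).
Proof.
move=> Ux; rewrite /christoffel.
under eq_bigr do rewrite mulrCA.
by rewrite -mulr_sumr lower_raise.
Qed.

(** [nabla g = 0]. *)
Lemma metric_compat c a b x : U x ->
  partial c (glo g a b) x =
  \sum_e glo g b e x * christoffel g e c a x +
  \sum_e glo g a e x * christoffel g e c b x.
Proof.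
move=> Ux; rewrite !christoffel_lo // (partial_glo_sym c b a Ux).
by rewrite (partial_glo_sym b c a Ux) (partial_glo_sym a c b Ux); field.
Qed.

(** Raising an index commutes with the covariant derivative. *)
Lemma partial_raise (w : 'I_4 -> pt R -> R) c d x : U x ->
  (forall e, smooth_on U (w e)) ->
  partial c (fun y => \sum_e gup g d e y * w e y) x =
  \sum_e gup g d e x * (partial c (w e) x - \sum_f christoffel g f c e x * w f x)
  - \sum_e christoffel g d c e x * (\sum_f gup g e f x * w f x).
Proof.
move=> Ux sw.
pose v e y := \sum_f gup g e f y * w f y.
have sv e : smooth_on U (v e).
  by apply: (smooth_sum oU) => f; apply: (smoothM oU) => //; exact: smooth_gup.
have wE e : partial c (w e) x = \sum_f (partial c (glo g e f) x * v f x
    + glo g e f x * partial c (v f) x).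
  (* [v] has the raised components of [w]; differentiate [w_e = g_ef v^f], which
   avoids differentiating the inverse matrix. *)
  transitivity (partial c (fun y => \sum_f glo g e f y * v f y) x).
    apply: (partial_eq_on oU) => // y; rewrite inE => Uy.
    by rewrite lower_raise.
  rewrite (partial_sum oU Ux) //; last first.
    by move=> f; apply: (smoothM oU) => //; exact: smooth_glo.
  by apply: eq_bigr => f _; rewrite (partialM Ux) //; exact: smooth_glo.
have key e : partial c (w e) x - \sum_f christoffel g f c e x * w f x =
    \sum_f glo g e f x * (partial c (v f) x + \sum_b christoffel g f c b x * v b x).
  have -> : \sum_f christoffel g f c e x * w f x =
      \sum_b (\sum_f glo g b f x * christoffel g f c e x) * v b x.
    under [RHS]eq_bigr do rewrite mulr_suml.
    rewrite exchange_big; apply: eq_bigr => f _.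
    rewrite -(lower_raise (w ^~ x) f Ux) mulr_sumr; apply: eq_bigr => b _.
    by rewrite (glo_sym f b Ux); rewrite /v; ring.
  have -> : \sum_f glo g e f x * (partial c (v f) x + \sum_b christoffel g f c b x * v b x)
     = \sum_f glo g e f x * partial c (v f) x +
       \sum_b (\sum_f glo g e f x * christoffel g f c b x) * v b x.
    under eq_bigr do rewrite mulrDr.
    rewrite big_split /=; congr (_ + _).
    under eq_bigr do rewrite mulr_sumr.
    rewrite exchange_big; apply: eq_bigr => b _; rewrite mulr_suml.
    by apply: eq_bigr => f _; rewrite mulrA.
  rewrite wE big_split /= addrAC addrC; congr (_ + _).
  rewrite -sumrB; apply: eq_bigr => b _.
  by rewrite metric_compat //; ring.
under [X in _ = X - _]eq_bigr do rewrite key.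
rewrite raise_lower // -/(v _) addrK.
by [].
Qed.

End LeviCivita.

(** * The curvature of a metric at a point *)

Section CurvatureAtPoint.
Context {R : realType} (U : set (pt R)) (oU : open U).
Variables (g : comps R 0 2) (mg : metric_on U g).
Implicit Types (a b c d e f : 'I_4) (x : pt R).

Definition glo_at x a b := glo g a b x.
Definition gup_at x a b := gup g a b x.
Definition christoffel_at x c a b := christoffel g c a b x.
Definition dchristoffel_at x l c a b := partial l (christoffel g c a b) x.
Definition dglo_at x l a b := partial l (glo g a b) x.
Definition riemann_at x a b c d := riemann g a b c d x.

(** The second covariant derivative of the coordinate covector [dx^d] produces
    the classical formula, because [nabla_b (dx^d)_c = - Gamma^d_bc]. *)
Lemma riemannE x a b c d : U x ->
  riemann g a b c d x = curv (christoffel_at x) (dchristoffel_at x) a b c d.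
Proof.
move=> Ux.
have dw u v : nabla g (coord_covector d) [tuple] [tuple u; v] =
    (fun y => - christoffel g d u v y).
  apply/funext => y; rewrite nabla_covector /coord_covector partial_cst sub0r.
  by rewrite sum_kronr.
have sG u v : smooth_on U (christoffel g d u v) by exact: smooth_christoffel.
have mN (F : 'I_4 -> R) (u v : 'I_4 -> 'I_4) :
    \sum_e F e * nabla g (coord_covector d) [tuple] [tuple u e; v e] x =
    - \sum_e F e * christoffel g d (u e) (v e) x.
  by rewrite -sumrN; apply: eq_bigr => e _; rewrite dw mulrN.
have sS : \sum_e christoffel_at x e b a * christoffel_at x d e c =
    \sum_e christoffel_at x e a b * christoffel_at x d e c.
  apply: eq_bigr => e _; congr (_ * _); exact: (christoffel_sym oU mg e b a Ux).
rewrite /riemann !nabla_bilinear !dw !(partialN Ux) //.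
rewrite (mN _ id (fun=> c)) (mN _ (fun=> b) id) (mN _ id (fun=> c)).
rewrite (mN _ (fun=> a) id) /curv.
rewrite -!/(christoffel_at x _ _ _) sS /dchristoffel_at.
move: (partial a _ _) (partial b _ _) => y z.
by sum_ring.
Qed.

Lemma riemann_atE x : U x ->
  riemann_at x = curv (christoffel_at x) (dchristoffel_at x).
Proof. by move=> Ux; do 4! apply/funext => ?; exact: riemannE. Qed.

Lemma smooth_riemann a b c d : smooth_on U (riemann g a b c d).
Proof.
have sG u v w : smooth_on U (christoffel g u v w) by exact: smooth_christoffel.
have sS i j k l : smooth_on U
    (fun x => \sum_e christoffel g e i j x * christoffel g k l e x).
  by apply: (smooth_sum oU) => e; exact: (smoothM oU).
have sR := smoothB oU (smoothD oU (smoothD oU (smoothN oU (smooth_partial a (sG d b c)))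
  (smooth_partial b (sG d a c))) (sS a c d b)) (sS b c d a).
by apply: (smooth_eq_on oU _ sR) => x; rewrite inE => Ux; rewrite riemannE.
Qed.

Lemma smooth_Llo a b : smooth_on U (Llo g a b).
Proof.
have sRic i j : smooth_on U (ricci g i j).
  by apply: (smooth_sum oU) => e; exact: smooth_riemann.
apply: (smoothM oU); first exact: smooth_cst.
apply: (smoothB oU); first exact: sRic.
apply: (smoothM oU); last exact: smooth_glo.
apply: (smoothM oU); first exact: smooth_cst.
apply: (smooth_sum oU) => i; apply: (smooth_sum oU) => j.
by apply: (smoothM oU); [exact: smooth_gup|exact: sRic].
Qed.

Section Point.
Variables (x : pt R) (Ux : U x).

Lemma glo_at_sym a b : glo_at x a b = glo_at x b a.
Proof. exact: (glo_sym mg a b Ux). Qed.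

Lemma gup_at_sym a b : gup_at x a b = gup_at x b a.
Proof. exact: (gup_sym mg a b Ux). Qed.

Lemma glo_gup_at a c : \sum_b glo_at x a b * gup_at x b c = kron R a c.
Proof. exact: (glo_gup mg a c Ux). Qed.

Lemma christoffel_at_sym c a b : christoffel_at x c a b = christoffel_at x c b a.
Proof. exact: (christoffel_sym oU mg c a b Ux). Qed.

Lemma dchristoffel_at_sym l c a b : dchristoffel_at x l c a b = dchristoffel_at x l c b a.
Proof.
apply: (partial_eq_on oU _ _ Ux) => y; rewrite inE => Uy.
exact: (christoffel_sym oU mg c a b Uy).
Qed.

Lemma metric_compat_at l a b : dglo_at x l a b =
  \sum_e glo_at x b e * christoffel_at x e l a + \sum_e glo_at x a e * christoffel_at x e l b.
Proof. exact: (metric_compat oU mg l a b Ux). Qed.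

Lemma riemann_at_antisym a b c d : riemann_at x a b c d = - riemann_at x b a c d.
Proof. by rewrite riemann_atE // curv_antisym. Qed.

Lemma riemann_at_bianchi a b c d :
  riemann_at x a b c d + riemann_at x b c a d + riemann_at x c a b d = 0.
Proof.
rewrite riemann_atE //; apply: curv_bianchi.
  exact: christoffel_at_sym.
exact: dchristoffel_at_sym.
Qed.

Lemma riemann_at_antisym2 a b c d :
  lower_last (glo_at x) (riemann_at x) a b c d =
  - lower_last (glo_at x) (riemann_at x) a b d c.
Proof.
pose F u v w y := \sum_e glo g u e y * christoffel g e v w y.
have sGa u v w : smooth_on U (christoffel g u v w) by exact: smooth_christoffel.
have sg u v : smooth_on U (glo g u v) by exact: smooth_glo.
have sF u v w : smooth_on U (F u v w).
  by apply: (smooth_sum oU) => e; exact: (smoothM oU).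
rewrite riemann_atE //.
apply: (@lower_curv_antisym _ _ _ (glo_at x) (dglo_at x)
  (fun l u v w => partial l (F u v w) x)).
- exact: glo_at_sym.
- exact: metric_compat_at.
- move=> l u v w; rewrite /F (partial_sum oU Ux); last first.
    by move=> e; exact: (smoothM oU).
  by apply: eq_bigr => e _; rewrite (partialM Ux).
- have FF k l i j : partial k (F j l i) x + partial k (F i l j) x =
      partial k (partial l (glo g i j)) x.
    rewrite -(partialD Ux) //; apply: (partial_eq_on oU _ _ Ux) => y.
    by rewrite inE => Uy; rewrite (metric_compat oU mg l i j Uy).
  move=> k l i j; apply: etrans (FF k l i j) _; apply: etrans _ (esym (FF l k i j)).
  exact: (partial_comm oU Ux k l (sg i j)).
Qed.

Lemma weyl_at : (fun a b c d => weyl g a b c d x) =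
  weylA (glo_at x) (gup_at x) (riemann_at x).
Proof. by []. Qed.

Lemma Lambda_at d : Lambda g d x =
  lambdaA (glo_at x) (gup_at x) (fun a b c d => weyl g a b c d x)
    (fun m p a => nabla_L g m p a x) d.
Proof. by []. Qed.

Lemma nabla_L_at m p a : nabla_L g m p a x =
  nabla2 (christoffel_at x) (fun l i j => partial l (Llo g i j) x)
    (schA (glo_at x) (gup_at x) (riemann_at x)) m p a.
Proof. by rewrite /nabla_L nabla_bilinear. Qed.

End Point.
End CurvatureAtPoint.

(** * Two conformal metrics: the connection *)

Section ConformalMetrics.
Context {R : realType} (U : set (pt R)) (oU : open U).
Variables (g gt : comps R 0 2) (mg : metric_on U g) (mgt : metric_on U gt).
Variable th : pt R -> R.
Hypothesis sth : smooth_on U th.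
Hypothesis th_gt0 : forall x, U x -> 0 < th x.
Hypothesis gE : forall x, U x -> forall A B, g A B x = th x ^+ 2 * gt A B x.
Implicit Types (a b c d e f : 'I_4) (x : pt R).

(** [dlog a] is the derivative of the logarithm of the conformal factor. *)
Definition dlog a x := partial a th x / th x.

Lemma th_neq0 x : U x -> th x != 0.
Proof. by move=> Ux; rewrite gt_eqF ?th_gt0. Qed.

Lemma smooth_dlog a : smooth_on U (dlog a).
Proof.
apply: (smoothM oU); first exact: smooth_partial.
by apply: (smoothV oU) => // x; exact: th_neq0.
Qed.

(** Differentiate [d_b th = dlog b * th] and compare the two mixed derivatives of
    [th]. *)
Lemma partial_dlog_sym a b x : U x -> partial a (dlog b) x = partial b (dlog a) x.
Proof.
move=> Ux.
have thE i y : U y -> partial i th y = dlog i y * th y.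
  by move=> Uy; rewrite /dlog divfK ?th_neq0.
have E i j : partial i (partial j th) x =
    partial i (dlog j) x * th x + dlog j x * (dlog i x * th x).
  transitivity (partial i (fun y => dlog j y * th y) x).
    by apply: (partial_eq_on oU _ _ Ux) => y; rewrite inE => Uy; exact: thE.
  by rewrite (partialM Ux _ (smooth_dlog j) sth) (thE i x Ux).
have := partial_comm oU Ux a b sth; rewrite (E a b) (E b a).
rewrite (mulrCA (dlog b x)) => /addIr; exact: (mulIf (th_neq0 Ux)).
Qed.

Lemma glo_conf a b x : U x -> glo g a b x = th x ^+ 2 * glo gt a b x.
Proof. by move=> Ux; rewrite !gloE gE. Qed.

Lemma glot_conf a b x : U x -> glo gt a b x = (th x ^+ 2)^-1 * glo g a b x.
Proof. by move=> Ux; rewrite glo_conf // mulKf // expf_neq0 // th_neq0. Qed.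

Lemma gupt_conf a b x : U x -> gup gt a b x = th x ^+ 2 * gup g a b x.
Proof.
move=> Ux.
have t0 : th x ^+ 2 != 0 by rewrite expf_neq0 // th_neq0.
have E : gmx g x = th x ^+ 2 *: gmx gt x.
  by apply/matrixP => i j; rewrite [RHS]mxE; exact: glo_conf.
rewrite /gup E invmxZ ?unitfE // ?mxE ?mulVKf //.
by rewrite -E; exact: (mg.2 x Ux).2.
Qed.

Lemma partial_glot c a b x : U x ->
  th x ^+ 2 * partial c (glo gt a b) x = partial c (glo g a b) x - 2 * dlog c x * glo g a b x.
Proof.
move=> Ux.
have -> : partial c (glo g a b) x = partial c (fun y => th y * (th y * glo gt a b y)) x.
  apply: (partial_eq_on oU _ _ Ux) => y; rewrite inE => Uy.
  by rewrite glo_conf // expr2 mulrA.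
have sg := smooth_glo oU mgt a b.
rewrite (partialM Ux _ sth (smoothM oU sth sg)) (partialM Ux _ sth sg) glo_conf // /dlog.
move: (partial _ _ _) (partial _ _ _) (glo _ _ _ _) (th_neq0 Ux) => y z w; move: (th x) => t t0.
by field.
Qed.

Definition Uup d x := \sum_e gup g d e x * dlog e x.

Lemma smooth_Uup d : smooth_on U (Uup d).
Proof.
apply: (smooth_sum oU) => e; apply: (smoothM oU); first exact: smooth_gup.
exact: smooth_dlog.
Qed.

Lemma christoffel_conf c a b x : U x ->
  christoffel gt c a b x =
  christoffel g c a b x - kron R c a * dlog b x - kron R c b * dlog a x
  + glo g a b x * Uup c x.
Proof.
move=> Ux; rewrite -!(gup_glo mg _ _ Ux) {1}/christoffel.
under eq_bigr do rewrite gupt_conf //.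
rewrite /christoffel /Uup !mulr_suml !mulr_sumr -!sumrB -big_split.
apply: eq_bigr => d _ /=.
rewrite (glo_sym mg d a Ux) (glo_sym mg d b Ux).
move: (partial_glot a b d Ux) (partial_glot b a d Ux) (partial_glot d a b Ux).
move: (partial a _ _) (partial b _ _) (partial d _ _) => y1 y2 y3.
move: (partial a _ _) (partial b _ _) (partial d _ _) => z1 z2 z3.
move: (gup _ _ _ _) (glo _ _ _ _) (glo _ _ _ _) (glo _ _ _ _) => p1 p2 p3 p4.
move: (dlog _ _) (dlog _ _) (dlog _ _) (th x ^+ 2) => q1 q2 q3 t E1 E2 E3.
have -> : t * p1 * (y1 + y2 - y3) = p1 * (t * y1 + t * y2 - t * y3) by ring.
by rewrite E1 E2 E3; field.
Qed.

End ConformalMetrics.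

(** * Two conformal metrics: curvature and Lambda *)

Section ConformalCurvature.
Context {R : realType} (U : set (pt R)) (oU : open U).
Variables (g gt : comps R 0 2) (mg : metric_on U g) (mgt : metric_on U gt).
Variable th : pt R -> R.
Hypothesis sth : smooth_on U th.
Hypothesis th_gt0 : forall x, U x -> 0 < th x.
Hypothesis gE : forall x, U x -> forall A B, g A B x = th x ^+ 2 * gt A B x.
Implicit Types (a b c d e f : 'I_4) (x : pt R).

Let sdlog a : smooth_on U (dlog th a) := smooth_dlog oU sth th_gt0 a.
Let sUup d : smooth_on U (Uup g th d) := smooth_Uup oU mg sth th_gt0 d.
Let sglo a b : smooth_on U (glo g a b) := smooth_glo oU mg a b.
Let sGam c a b : smooth_on U (christoffel g c a b) := smooth_christoffel oU mg c a b.

(* The arrays to which the algebra of conformal change is applied at [x]. *)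
Let u x a := dlog th a x.
Let du x a b := partial a (dlog th b) x.
Let duu x a d := partial a (Uup g th d) x.
Let ddu x m p a := partial m (partial p (dlog th a)) x.
Let P x := Pconf (glo_at g x) (gup_at g x) (christoffel_at g x) (u x) (du x).
Let dP x := dPconf (glo_at g x) (gup_at g x) (christoffel_at g x)
  (dchristoffel_at g x) (dglo_at g x) (u x) (du x) (duu x) (ddu x).

Let uuE x : raised_covector (gup_at g x) (u x) = fun d => Uup g th d x.
Proof. by []. Qed.

Lemma du_sym x : U x -> forall a b, du x a b = du x b a.
Proof. by move=> Ux a b; exact: (partial_dlog_sym oU sth th_gt0 a b Ux). Qed.

Lemma ddu_sym x : U x -> forall m p a, ddu x m p a = ddu x p m a.
Proof. by move=> Ux m p a; exact: (partial_comm oU Ux m p (sdlog a)). Qed.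

Lemma duuE x : U x -> forall a d, duu x a d =
  \sum_e gup_at g x d e * hess (christoffel_at g x) (u x) (du x) a e
  - \sum_e christoffel_at g x d a e * raised_covector (gup_at g x) (u x) e.
Proof. by move=> Ux a d; exact: (partial_raise oU mg a d Ux sdlog). Qed.

Lemma christoffel_at_conf x : U x -> christoffel_at gt x =
  Gconf (glo_at g x) (gup_at g x) (christoffel_at g x) (u x).
Proof.
move=> Ux; do 3! apply/funext => ?.
rewrite /christoffel_at (christoffel_conf oU mg mgt sth th_gt0 gE) //.
rewrite /Gconf /Qconf uuE /glo_at /u.
move: (christoffel _ _ _ _ _) (glo _ _ _ _) (Uup _ _ _ _) (dlog _ _ _) (dlog _ _ _) => *.
by ring.
Qed.

Lemma dchristoffel_at_conf x : U x -> dchristoffel_at gt x =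
  dGconf (glo_at g x) (gup_at g x) (dchristoffel_at g x) (dglo_at g x) (u x) (du x) (duu x).
Proof.
move=> Ux; apply/funext => l; apply/funext => c; apply/funext => a; apply/funext => b.
pose f1 y := kron R c a * dlog th b y.
pose f2 y := kron R c b * dlog th a y.
pose f3 y := glo g a b y * Uup g th c y.
have s1 : smooth_on U f1 by apply: (smoothM oU) => //; exact: smooth_cst.
have s2 : smooth_on U f2 by apply: (smoothM oU) => //; exact: smooth_cst.
have s3 : smooth_on U f3 by exact: (smoothM oU).
have s4 := smoothB oU (sGam c a b) s1.
have s5 := smoothB oU s4 s2.
have p1 : partial l f1 x = kron R c a * partial l (dlog th b) x.
  exact: (partialZ oU Ux l (kron R c a) (sdlog b)).
have p2 : partial l f2 x = kron R c b * partial l (dlog th a) x.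
  exact: (partialZ oU Ux l (kron R c b) (sdlog a)).
transitivity (partial l (fun y => christoffel g c a b y - f1 y - f2 y + f3 y) x).
  apply: (partial_eq_on oU _ _ Ux) => y; rewrite inE => Uy.
  exact: (christoffel_conf oU mg mgt sth th_gt0 gE).
rewrite (partialD Ux _ s5 s3) (partialB Ux _ s4 s2) (partialB Ux _ (sGam c a b) s1).
rewrite p1 p2 (partialM Ux _ (sglo a b) (sUup c)).
by rewrite addrA /dGconf uuE.
Qed.

Lemma riemann_at_conf x : U x -> forall a b c d, riemann_at gt x a b c d =
  riemann_at g x a b c d + kron R d b * P x a c - kron R d a * P x b c
  + glo_at g x a c * (\sum_e gup_at g x d e * P x e b)
  - glo_at g x b c * (\sum_e gup_at g x d e * P x e a).
Proof.
move=> Ux a b c d.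
rewrite (riemann_atE oU mgt Ux) (riemann_atE oU mg Ux).
rewrite (christoffel_at_conf Ux) (dchristoffel_at_conf Ux).
exact: (curv_conformal (glo_at_sym mg Ux) (gup_at_sym mg Ux) (glo_gup_at mg Ux)
  (dchristoffel_at g x) (christoffel_at_sym oU mg Ux) (du_sym Ux) (duuE Ux)
  (metric_compat_at oU mg Ux)).
Qed.

Lemma P_sym x : U x -> forall a b, P x a b = P x b a.
Proof.
move=> Ux a b; apply: Pconf_sym.
- exact: (glo_at_sym mg Ux).
- exact: (christoffel_at_sym oU mg Ux).
- exact: (du_sym Ux).
Qed.

Let th20 x : U x -> th x ^+ 2 != 0.
Proof. by move=> Ux; rewrite expf_neq0 // gt_eqF ?th_gt0. Qed.

Lemma glo_at_conf x : U x -> glo_at gt x = scaled_lower (glo_at g x) (th x ^+ 2).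
Proof.
by move=> Ux; do 2! apply/funext => ?; exact: (glot_conf th_gt0 gE).
Qed.

Lemma gup_at_conf x : U x -> gup_at gt x = scaled_upper (gup_at g x) (th x ^+ 2).
Proof.
by move=> Ux; do 2! apply/funext => ?; exact: (gupt_conf mg th_gt0 gE).
Qed.

Lemma schouten_conf x : U x -> forall a b, Llo gt a b x = Llo g a b x + P x a b.
Proof.
move=> Ux a b.
transitivity (schA (glo_at gt x) (gup_at gt x) (riemann_at gt x) a b); first by [].
rewrite (glo_at_conf Ux) (gup_at_conf Ux).
exact: (sch_conformal (glo_at_sym mg Ux) (gup_at_sym mg Ux) (glo_gup_at mg Ux) (th20 Ux)
  (P_sym Ux) (riemann_at_conf Ux)).
Qed.

Lemma weyl_conf x : U x -> (fun a b c d => weyl gt a b c d x) =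
  (fun a b c d => weyl g a b c d x).
Proof.
move=> Ux; rewrite !weyl_at (glo_at_conf Ux) (gup_at_conf Ux).
do 4! apply/funext => ?.
exact: (weyl_conformal (glo_at_sym mg Ux) (gup_at_sym mg Ux) (glo_gup_at mg Ux) (th20 Ux)
  (P_sym Ux) (riemann_at_conf Ux)).
Qed.

Lemma smooth_hess a b :
  smooth_on U (fun x => hess (christoffel_at g x) (u x) (du x) a b).
Proof.
apply: (smoothB oU); first exact: smooth_partial.
apply: (smooth_sum oU) => e; exact: (smoothM oU (sGam e a b) (sdlog e)).
Qed.

Lemma smooth_norm2 : smooth_on U (fun x => norm2 (gup_at g x) (u x)).
Proof. apply: (smooth_sum oU) => e; exact: (smoothM oU (sUup e) (sdlog e)). Qed.

(** The array computation of the curl of [L] refers to the derivative of [P]; it is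
    the derivative of an actual field. *)
Lemma partial_P x m p a : U x -> partial m (fun y => P y p a) x = dP x m p a.
Proof.
move=> Ux.
pose f1 y := hess (christoffel_at g y) (u y) (du y) p a.
pose f2 y := dlog th p y * dlog th a y.
pose n2 y := norm2 (gup_at g y) (u y).
pose f3 y := 2^-1 * n2 y.
pose f4 y := f3 y * glo g p a y.
have s1 : smooth_on U f1 by exact: smooth_hess.
have s2 : smooth_on U f2 by exact: (smoothM oU (sdlog p) (sdlog a)).
have sn : smooth_on U n2 by exact: smooth_norm2.
have s3 : smooth_on U f3 by exact: (smoothM oU (smooth_cst oU 2^-1) sn).
have s4 : smooth_on U f4 by exact: (smoothM oU s3 (sglo p a)).
have sGu e : smooth_on U (fun y => christoffel g e p a y * dlog th e y).
  exact: (smoothM oU (sGam e p a) (sdlog e)).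
have p1 : partial m f1 x =
    dhess (christoffel_at g x) (dchristoffel_at g x) (u x) (du x) (ddu x) m p a.
  transitivity (partial m (partial p (dlog th a)) x
      - partial m (fun y => \sum_e christoffel g e p a y * dlog th e y) x).
    exact: (partialB Ux m (smooth_partial p (sdlog a)) (smooth_sum oU _ sGu)).
  rewrite (partial_sum oU Ux _ _ sGu); congr (_ - _); apply: eq_bigr => e _.
  exact: (partialM Ux m (sGam e p a) (sdlog e)).
have sUu e : smooth_on U (fun y => Uup g th e y * dlog th e y).
  exact: (smoothM oU (sUup e) (sdlog e)).
have p3 : partial m n2 x = dnorm2 (gup_at g x) (u x) (du x) (duu x) m.
  apply: etrans (partial_sum oU Ux _ m sUu) _; apply: eq_bigr => e _.
  exact: (partialM Ux m (sUup e) (sdlog e)).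
transitivity (partial m (fun y => f1 y + f2 y - f4 y) x); first by [].
rewrite (partialB Ux _ (smoothD oU s1 s2) s4) (partialD Ux _ s1 s2) p1.
rewrite (partialM Ux _ (sdlog p) (sdlog a)) (partialM Ux _ s3 (sglo p a)).
have pf3 : partial m f3 x = 2^-1 * partial m n2 x by exact: (partialZ oU Ux m 2^-1 sn).
rewrite pf3 p3.
have -> : f3 x = 2^-1 * n2 x by [].
rewrite -(mulrA 2^-1 (dnorm2 _ _ _ _ _)) -(mulrA 2^-1 (n2 x)) -mulrDr.
exact: erefl.
Qed.

(** The Schouten tensors of the two metrics differ by [P] on all of [U], so this
    relation may be differentiated and [cotton_conformal] applies. *)
Lemma nabla_L_conf x m p a : U x ->
  nabla_L gt m p a x - nabla_L gt p m a x =
  nabla_L g m p a x - nabla_L g p m a x + \sum_e weyl g m p a e x * u x e.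
Proof.
move=> Ux.
have dLE i j k : partial i (Llo gt j k) x = partial i (Llo g j k) x + dP x i j k.
  transitivity (partial i (fun y => Llo g j k y + P y j k) x).
    apply: (partial_eq_on oU _ _ Ux) => y; rewrite inE => Uy.
    exact: schouten_conf.
  have sP : smooth_on U (fun y => P y j k).
    apply: (smoothB oU).
      apply: (smoothD oU); first exact: smooth_hess.
      exact: (smoothM oU (sdlog j) (sdlog k)).
    exact: (smoothM oU (smoothM oU (smooth_cst oU 2^-1) smooth_norm2) (sglo j k)).
  by rewrite (partialD Ux _ (smooth_Llo oU mg j k) sP) partial_P.
have NE i j : nabla_L gt i j a x = nabla2 (Gconf (glo_at g x) (gup_at g x) (christoffel_at g x) (u x))
    (fun l i j => partial l (Llo g i j) x + dP x l i j)
    (fun i j => schA (glo_at g x) (gup_at g x) (riemann_at g x) i j + P x i j) i j a.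
  rewrite nabla_L_at -(christoffel_at_conf Ux) /nabla2 dLE.
  by congr (_ - _ - _); apply: eq_bigr => e _; congr (_ * _); exact: schouten_conf.
rewrite !NE.
have Ls := sch_sym (glo_at_sym mg Ux) (gup_at_sym mg Ux) (glo_gup_at mg Ux)
  (riemann_at_antisym oU mg Ux) (riemann_at_antisym2 oU mg Ux) (riemann_at_bianchi oU mg Ux).
rewrite (cotton_conformal (glo_at_sym mg Ux) (gup_at_sym mg Ux) (glo_gup_at mg Ux)
  (dchristoffel_at g x) (christoffel_at_sym oU mg Ux) (du_sym Ux) (duuE Ux)
  (metric_compat_at oU mg Ux) _ m p a Ls (ddu_sym Ux)).
rewrite -(riemann_atE oU mg Ux).
have -> : \sum_e weyl g m p a e x * u x e =
    \sum_e weylA (glo_at g x) (gup_at g x) (riemann_at g x) m p a e * u x e by [].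
rewrite (sum_weyl_covector (gup_at_sym mg Ux) (u x) m p a Ls) !nabla_L_at.
by rewrite !addrA.
Qed.

Lemma Lambda_conf x d : U x -> weyl_sq g x != 0 -> Lambda gt d x = Lambda g d x - dlog th d x.
Proof.
move=> Ux sq0.
rewrite !Lambda_at (weyl_conf Ux) (glo_at_conf Ux) (gup_at_conf Ux).
have sym1 := glo_at_sym mg Ux; have sym2 := gup_at_sym mg Ux.
have inv := glo_gup_at mg Ux.
have R1 := riemann_at_antisym oU mg Ux.
have R2 := riemann_at_antisym2 oU mg Ux.
have R3 := riemann_at_bianchi oU mg Ux.
have C1 := weyl_antisym sym1 inv R1.
have C2 := weyl_antisym2 sym1 sym2 inv R1 R2 R3.
have C4 := weyl_pair sym1 sym2 inv R1 R2 R3.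
have Ctr := weyl_trace sym1 sym2 inv R1 R2 R3.
have NE m p a := nabla_L_conf m p a Ux.
exact: (lambda_conformal (N := fun m p a => nabla_L g m p a x)
  (Nt := fun m p a => nabla_L gt m p a x) (u := u x)
  sym1 sym2 inv (th20 Ux) C1 C2 C4 Ctr NE d sq0).
Qed.

End ConformalCurvature.

(** * The conformal pseudo-differential *)

Section PseudoDifferential.
Context {R : realType} (U : set (pt R)) (oU : open U).
Variables (g gt : comps R 0 2) (mg : metric_on U g) (mgt : metric_on U gt).
Variable th : pt R -> R.
Hypothesis sth : smooth_on U th.
Hypothesis th_gt0 : forall x, U x -> 0 < th x.
Hypothesis gE : forall x, U x -> forall A B, g A B x = th x ^+ 2 * gt A B x.
Hypothesis sq0 : forall x, U x -> weyl_sq g x != 0.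
Implicit Types (a b c d e : 'I_4) (x : pt R).

Let th0 x : U x -> th x != 0.
Proof. by move=> Ux; rewrite gt_eqF ?th_gt0. Qed.

Lemma partial_exprn a (n : nat) x : U x ->
  partial a (fun y => th y ^+ n) x = n%:R * dlog th a x * th x ^+ n.
Proof.
move=> Ux; elim: n => [|n IH]; first by rewrite !mul0r (partial_cst a 1).
transitivity (partial a (fun y => th y * th y ^+ n) x).
  by apply: (partial_eq_on oU _ _ Ux) => y _; rewrite exprS.
rewrite (partialM Ux _ sth (smooth_exprn oU n sth)) IH /dlog exprS -natr1.
by move: (partial _ _ _) (th x) (th0 Ux) (th x ^+ n) (n%:R) => y t t0 z k; field.
Qed.

Lemma smooth_exprz (s : int) : smooth_on U (fun y => th y ^ s).
Proof.
case: s => n; first exact: smooth_exprn.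
apply: (smoothV oU); last exact: smooth_exprn.
by move=> x Ux; rewrite expf_neq0 // th0.
Qed.

(** For a negative exponent, differentiate [th ^ s * th ^+ n = 1]. *)
Lemma partial_exprz a (s : int) x : U x ->
  partial a (fun y => th y ^ s) x = s%:~R * dlog th a x * th x ^ s.
Proof.
move=> Ux; case: s => n; first exact: partial_exprn.
have t0 : th x ^+ n.+1 != 0 by rewrite expf_neq0 // th0.
apply: (mulIf t0).
have := partialM Ux a (smooth_exprz (Negz n)) (smooth_exprn oU n.+1 sth).
have -> : partial a (fun y => th y ^ Negz n * th y ^+ n.+1) x = 0.
  apply: etrans (partial_cst a 1 x); apply: (partial_eq_on oU _ _ Ux) => y.
  by rewrite inE => Uy; rewrite /exprz mulVf // expf_neq0 // th0.
rewrite partial_exprn // => /esym/eqP; rewrite addr_eq0 => /eqP ->.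
by rewrite NegzE mulrNz; move: (th x ^ _) (th x ^+ _) (dlog _ _ _) => *; ring.
Qed.

Section Corrections.
Variables (r : nat) (s : int) (r_gt0 : (0 < r)%N).

Let r0 : r%:R != 0 :> R.
Proof. by rewrite pnatr_eq0 -lt0n. Qed.

Lemma raise_Lambda_conf b c k x : U x ->
  glo gt b c x * (\sum_d gup gt k d x * Lambda gt d x) =
  glo g b c x * (\sum_d gup g k d x * Lambda g d x - Uup g th k x).
Proof.
move=> Ux; rewrite (glot_conf th_gt0 gE) // -mulrA mulrCA; congr (_ * _).
rewrite mulr_sumr /Uup -sumrB; apply: eq_bigr => d _.
rewrite (gupt_conf mg th_gt0 gE) // (Lambda_conf oU mg mgt sth th_gt0 gE) ?sq0 //.
move: (gup _ _ _ _) (Lambda _ _ _) (dlog _ _ _) (th x) (th0 Ux) => y z w t t0.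
by field.
Qed.

(** Replacing [g] by [gt] shifts the connection by [Q] and, by [Lambda_conf], the
    weight-free terms of [Mcon] by [- Q]; what survives is diagonal in the
    exchanged index. *)
Lemma contravariant_correction k a c x : U x ->
  christoffel gt k a c x + Mcon gt r s k a c x =
  christoffel g k a c x + Mcon g r s k a c x
  - s%:~R / r%:R * dlog th a x * kron R k c.
Proof.
move=> Ux; rewrite (christoffel_conf oU mg mgt sth th_gt0 gE) // /Mcon.
rewrite raise_Lambda_conf // !(Lambda_conf oU mg mgt sth th_gt0 gE) ?sq0 //.
rewrite (kronC c k) (kronC a k) (glo_sym mg c a Ux) ctrE; move: (ctr _) (Uup _ _ _ _) => y z.
move: (christoffel _ _ _ _ _) (Lambda _ _ _) (Lambda _ _ _) (glo _ _ _ _) => *.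
move: (dlog _ _ _) (dlog _ _ _) (kron _ _ _) (kron _ _ _) (r%:R) r0 (s%:~R) => *.
by field.
Qed.

Lemma covariant_correction k a b x : U x ->
  - christoffel gt k a b x + Mcov gt r s k a b x =
  - christoffel g k a b x + Mcov g r s k a b x
  - s%:~R / r%:R * dlog th a x * kron R b k.
Proof.
move=> Ux; rewrite (christoffel_conf oU mg mgt sth th_gt0 gE) // /Mcov.
rewrite raise_Lambda_conf // !(Lambda_conf oU mg mgt sth th_gt0 gE) ?sq0 //.
rewrite (kronC k b) (kronC k a) (glo_sym mg b a Ux) ctrE; move: (ctr _) (Uup _ _ _ _) => y z.
move: (christoffel _ _ _ _ _) (Lambda _ _ _) (Lambda _ _ _) (glo _ _ _ _) => *.
move: (dlog _ _ _) (dlog _ _ _) (kron _ _ _) (kron _ _ _) (r%:R) r0 (s%:~R) => *.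
by field.
Qed.
End Corrections.

(** The connection and the correction enter only through their sum. *)
Lemma DconfE (h : comps R 0 2) (s : int) (p q : nat) (K : comps R p q)
    (A : idx p) (aB : idx q.+1) x :
  let a := thead aB in let B := [tuple of behead aB] in
  Dconf h s K A aB x = partial a (K A B) x
  + \sum_(j < p) \sum_c (christoffel h (tnth A j) a c x
       + Mcon h (p + q) s (tnth A j) a c x) * K (subst_idx A j c) B x
  + \sum_(j < q) \sum_c (- christoffel h c a (tnth B j) x
       + Mcov h (p + q) s c a (tnth B j) x) * K A (subst_idx B j c) x.
Proof.
move=> a B; rewrite /Dconf /nabla.
have E (n : nat) (X Y : 'I_n -> 'I_4 -> R) (Z : 'I_n -> 'I_4 -> R) :
    \sum_(j < n) \sum_c (X j c + Y j c) * Z j c =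
    \sum_(j < n) \sum_c X j c * Z j c + \sum_(j < n) \sum_c Y j c * Z j c.
  rewrite -big_split; apply: eq_bigr => j _; rewrite -big_split.
  by apply: eq_bigr => c _; rewrite mulrDl.
rewrite !E.
have -> : \sum_(j < q) \sum_c - christoffel h c a (tnth B j) x * K A (subst_idx B j c) x =
    - \sum_(j < q) \sum_c christoffel h c a (tnth B j) x * K A (subst_idx B j c) x.
  rewrite -sumrN; apply: eq_bigr => j _; rewrite -sumrN.
  by apply: eq_bigr => c _; rewrite mulNr.
move: (partial _ _ _) => y.
do 4! [match goal with |- context [bigop ?a ?b ?c] => move: (bigop a b c) => ? end].
by ring.
Qed.

Lemma subst_idx_id k (A : idx k) j : subst_idx A j (tnth A j) = A.
Proof. by apply: eq_from_tnth => i; rewrite tnth_mktuple; case: eqP => [->|]. Qed.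

Lemma Dconf_conformal (s : int) (p q : nat) (K Kt : comps R p q) :
  (0 < p + q)%N -> (forall A B, smooth_on U (K A B)) ->
  (forall x, U x -> forall A B, Kt A B x = th x ^ s * K A B x) ->
  forall x, U x -> forall A B, Dconf gt s Kt A B x = th x ^ s * Dconf g s K A B x.
Proof.
move=> pq_gt0 sK KtE x Ux A aB; rewrite !DconfE.
set a := thead aB; set B := [tuple of behead aB].
have dK : partial a (Kt A B) x =
    th x ^ s * (partial a (K A B) x + s%:~R * dlog th a x * K A B x).
  transitivity (partial a (fun y => th y ^ s * K A B y) x).
    by apply: (partial_eq_on oU _ _ Ux) => y; rewrite inE => Uy; exact: KtE.
  rewrite (partialM Ux _ (smooth_exprz s) (sK A B)) partial_exprz //.
  by move: (partial _ _ _) (dlog _ _ _) (th x ^ s) => *; ring.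
have corr n (X Xt Z : 'I_n -> 'I_4 -> R) (w : R) (k : 'I_n -> 'I_4) :
    (forall j c, Xt j c = X j c - w * kron R (k j) c) ->
    (forall j, Z j (k j) = K A B x) ->
    \sum_(j < n) \sum_c Xt j c * (th x ^ s * Z j c) =
    th x ^ s * (\sum_(j < n) \sum_c X j c * Z j c - n%:R * w * K A B x).
  move=> XE ZE.
  have -> : n%:R * w * K A B x = \sum_(j < n) w * K A B x.
    by rewrite sumr_const card_ord -[RHS]mulr_natl mulrA.
  rewrite -sumrB mulr_sumr; apply: eq_bigr => j _.
  rewrite -(ZE j) -(sum_kron (k j) (Z j)) mulr_sumr -sumrB mulr_sumr.
  by apply: eq_bigr => c _; rewrite XE; ring.
rewrite dK; pose w := s%:~R / (p + q)%:R * dlog th a x.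
have -> : \sum_(j < p) \sum_c (christoffel gt (tnth A j) a c x
       + Mcon gt (p + q) s (tnth A j) a c x) * Kt (subst_idx A j c) B x =
    th x ^ s * (\sum_(j < p) \sum_c (christoffel g (tnth A j) a c x
       + Mcon g (p + q) s (tnth A j) a c x) * K (subst_idx A j c) B x - p%:R * w * K A B x).
  under eq_bigr do under eq_bigr do rewrite KtE //.
  apply: (corr p _ _ _ w (tnth A)) => [j c|j].
    exact: contravariant_correction.
  by rewrite subst_idx_id.
have -> : \sum_(j < q) \sum_c (- christoffel gt c a (tnth B j) x
       + Mcov gt (p + q) s c a (tnth B j) x) * Kt A (subst_idx B j c) x =
    th x ^ s * (\sum_(j < q) \sum_c (- christoffel g c a (tnth B j) x
       + Mcov g (p + q) s c a (tnth B j) x) * K A (subst_idx B j c) x - q%:R * w * K A B x).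
  under eq_bigr do under eq_bigr do rewrite KtE //.
  apply: (corr q _ _ _ w (tnth B)) => [j c|j].
    exact: covariant_correction.
  by rewrite subst_idx_id.
have r0 : (p + q)%:R != 0 :> R by rewrite pnatr_eq0 -lt0n.
have sw : s%:~R * dlog th a x = p%:R * w + q%:R * w.
  rewrite -mulrDl -natrD /w; move: (dlog _ _ _) (s%:~R) ((p + q)%:R) r0 => y z k k0.
  by field.
rewrite sw; clearbody w; move: (partial a _ x) (th x ^ s) (K A B x) => y t z.
by sum_ring.
Qed.

End PseudoDifferential.

Theorem theorem2 (R : realType) (M : manifold4 R) (g gt : metric M)
    (Th : M -> R) (Th_smooth : smooth_fun Th) (Th_pos : forall m : M, 0 < Th m)
    (g_conf : forall (i : atlas M) (x : 'rV[R]_4), coord_dom i x ->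
       forall A B, g i A B x = Th (cinv (chart_of i) x) ^+ 2 * gt i A B x)
    (weyl_neq0 : forall (i : atlas M) (x : 'rV[R]_4), coord_dom i x ->
       weyl_sq (g i) x != 0)
    (p q : nat) (pq_neq0 : (p, q) <> (0%N, 0%N)) (s : int)
    (F : comps R 0 2 -> comps R p q) (F_concomitant : concomitant F)
    (K Kt : tensor_field M p q)
    (K_def : built_from F g K) (Kt_def : built_from F gt Kt)
    (K_cov : conf_covariant Th s K Kt) :
  conf_covariant Th s (fun i => Dconf (g i) s (K i))
                      (fun i => Dconf (gt i) s (Kt i)).
Proof.
move=> i x Ux A B.
have oU : open (coord_dom i) by exact: cimg_open.
apply: (Dconf_conformal oU (metric_nondeg g i) (metric_nondeg gt i) (Th_smooth i)
  (fun y _ => Th_pos _) (g_conf i) (weyl_neq0 i) _ _ (K_cov i) Ux).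
- by case: p q pq_neq0 {F F_concomitant K Kt K_def Kt_def K_cov A B} => [[]|].
- by move=> A' B'; exact: tcomps_smooth.
Qed.
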